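(* Let $m>0$, $r\ge0$, $s>0$ be real numbers with $0\le s-r\le m$, and let $\{X_t,t\ge0\}$ be the (null recurrent) $(m,r,m,s)$-linear growth model, i.e. the birth-death process on $\mathbb N=\{0,1,2,\dots\}$ with death rates $\alpha_n=mn+r$ ($n\ge1$) and birth rates $\beta_n=mn+s$ ($n\ge0$). Let $\tau$ be the first returning time to $0$ of the process started at $0$. (1) If $s-r=m$, then for $\gamma>0$, $E(\log^\gamma\tau)<\infty$ if and only if $0<\gamma<1$. (2) If $0\le s-r<m$, then for $a>0$, $E(\tau^a)<\infty$ if and only if $0<a<1-\dfrac{s-r}{m}$.
   Context: The birth-death process is the continuous-time Markov chain on $\mathbb N$ with conservative $Q$-matrix $q_{n,n+1}=\beta_n$ ($n\ge0$), $q_{n,n-1}=\alpha_n$ ($n\ge1$), $q_{nn}=-\sum_{j\ne n}q_{nj}$, and all other entries $0$; it is non-explosive and so uniquely determined by its $Q$-matrix. $\tau=\inf\{t>\eta_1:X_t=0\}$, where $\eta_1$ is the first jump time and $X_0=0$; $E$ is expectation for the process started at $0$. In (1), $\log^\gamma\tau$ is to be read as $w(\tau)$ with $w(t)=1$ for $0\le t\le e$ and $w(t)=(\log t)^\gamma$ for $t\ge e$ (i.e. $w(t)=1\vee\log^\gamma t$). *)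

(* Defs.v *)
From HB Require Import structures.
From mathcomp Require Import all_boot all_order all_algebra.
From mathcomp Require Import all_classical all_reals all_analysis.
Import Order.TTheory GRing.Theory Num.Theory numFieldNormedType.Exports.
Set Implicit Arguments.
Unset Strict Implicit.
Unset Printing Implicit Defensive.

Local Open Scope classical_set_scope.
Local Open Scope ring_scope.

(* The value [alpha 0] is never used. *)
Definition birth_death_rate (R : realType) (alpha beta : nat -> R)
    (i j : nat) : R :=
  if j == i.+1 then beta i else if i == j.+1 then alpha i else 0.

(* [birth_death_rate alpha beta i j] vanishes for [j >= i.+2], so the finite
   sum below is the full sum over [j <> i]: the Q-matrix is conservative. *)
Definition birth_death_Q (R : realType) (alpha beta : nat -> R)
    (i j : nat) : R :=
  if j == i then - \sum_(k < i.+2 | k != i :> nat) birth_death_rate alpha beta i k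
  else birth_death_rate alpha beta i j.

(* The (m, r, m', s)-linear growth model: deaths m n + r, births m' n + s. *)
Definition linear_growth_Q (R : realType) (m r m' s : R) : nat -> nat -> R :=
  birth_death_Q (fun n => m * n%:R + r) (fun n => m' * n%:R + s).

(* Only times [t >= 0] are constrained. *)
Record transition_function (R : realType) (p : R -> nat -> nat -> R) : Prop := {
  transition_ge0 : forall t i j, 0 <= t -> 0 <= p t i j ;
  transition_sum1 : forall t i, 0 <= t ->
    (\sum_(0 <= j <oo) (p t i j)%:E = 1)%E ;
  transition0 : forall i j, p 0 i j = (i == j)%:R ;
  transitionD : forall t u i j, 0 <= t -> 0 <= u ->
    (\sum_(0 <= k <oo) (p t i k * p u k j)%:E = (p (t + u) i j)%:E)%E
}.

Definition has_Q_matrix (R : realType) (p : R -> nat -> nat -> R)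
    (q : nat -> nat -> R) : Prop :=
  forall i j, (p h i j - (i == j)%:R) / h @[h --> 0^'+] --> q i j.

Section Chain.
Context {R : realType} {d : measure_display} {T : measurableType d}
  {P : probability T R}.
Implicit Type X : R -> {RV P >-> nat}.

(* Processes are indexed by [R], but only their values at times [t >= 0]
   matter. *)

Definition right_continuous_paths X : Prop :=
  forall (t : R) (w : T), 0 <= t -> \forall u \near t^'+, X u w = X t w.

(* The time-homogeneous Markov property, with the conditional probability
   P(X_{t_{n+1}} = i_{n+1} | X_{t_0} = i_0, ..., X_{t_n} = i_n)
   multiplied out. *)
Definition markov_with_transition X (p : R -> nat -> nat -> R) : Prop :=
  forall (n : nat) (t : nat -> R) (i : nat -> nat),
    0 <= t 0%N -> (forall k, (k <= n)%N -> t k < t k.+1) ->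
    (P (\bigcap_(k in `I_n.+2) (X (t k) @^-1` [set i k])) =
     P (\bigcap_(k in `I_n.+1) (X (t k) @^-1` [set i k])) *
       (p (t n.+1 - t n) (i n) (i n.+1))%:E)%E.

Definition is_Markov_chain X (q : nat -> nat -> R) (x0 : nat) : Prop :=
  [/\ right_continuous_paths X,
      P (X 0 @^-1` [set x0]) = 1%E &
      exists p : R -> nat -> nat -> R,
        [/\ transition_function p, has_Q_matrix p q &
            markov_with_transition X p]].

Definition first_jump_time X (w : T) : \bar R :=
  ereal_inf (EFin @` [set t : R | 0 <= t /\ X t w <> X 0 w]).

Definition return_time0 X (w : T) : \bar R :=
  ereal_inf (EFin @` [set t : R | (first_jump_time X w < t%:E)%E /\ X t w = 0%N]).

End Chain.

Definition log_weight (R : realType) (gamma : R) (x : \bar R) : \bar R :=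
  (if x <= (expR 1)%:E then 1 else lne x `^ gamma)%E.

(* Main.v *)
(** Let [h] be the scale function of the chain, [h n] being harmonic off [0].
    The tail of [tau] is read off from two comparison functions. From [1], the
    level [N] is reached before [0] with probability [h 1 / h N], and the mean
    exit time from [[1, N)] is at most [h N] times the total speed measure of
    [[1, N)]; this bounds [P (tau > t)] by a multiple of [1 / h N]. Conversely,
    once at level [M] the chain stays away from [0] for a time of order [M] with
    probability at least 1/2, as the parabola [n (2 M - n) / M ^ 2] shows, so
    that [P (tau >= t)] is at least a multiple of [1 / h M] for [t] of order
    [M]. The comparisons are made for the chain observed on a fine time grid and
    use only finitely many rows of the Q-matrix, so that neither non-explosion
    nor uniformity of the transition function is needed. Finally [h n] grows
    like [log n] if [s - r = m] and like [n ^ (1 - (s - r) / m)] otherwise, and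
    moments are compared with sums over geometric scales. *)

Require Import Defs.
From HB Require Import structures.
From mathcomp Require Import all_boot all_order all_algebra.
From mathcomp Require Import all_classical all_reals all_analysis.
From mathcomp Require Import measurable_realfun ring lra zify.
Import Order.TTheory GRing.Theory Num.Theory numFieldNormedType.Exports.
Local Open Scope classical_set_scope.
Local Open Scope ring_scope.

(** * One step of a chain with a birth-death Q-matrix *)

(** The sum is cut at [n], so the limit passes through finitely many entries of row [i] and is never
    exchanged with an infinite sum. *)
Lemma cvg_sum_transition {R : realType} (p : R -> nat -> nat -> R)
    (q : nat -> nat -> R) (f : nat -> R) (i n : nat) :
  has_Q_matrix p q -> (i < n)%N ->
  (\sum_(j < n) p h i j * f j - f i) / h @[h --> 0^'+] -->
  \sum_(j < n) q i j * f j.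
Proof.
move=> pQ ltin.
have -> : (fun h => (\sum_(j < n) p h i j * f j - f i) / h) =
    (fun h => \sum_(j < n) ((p h i j - (i == j)%:R) / h * f j)).
  apply/funext => h.
  have -> : f i = \sum_(j < n) (i == j)%:R * f j.
    rewrite (bigD1 (Ordinal ltin))//= eqxx mul1r big1 ?addr0// => j.
    by rewrite -val_eqE/= eq_sym => /negbTE ->; rewrite mul0r.
  rewrite -sumrB mulr_suml; apply: eq_bigr => j _.
  by rewrite -mulrBl mulrAC.
apply: cvg_big => [x|j _]; first exact: add_continuous.
by apply: cvgMr_tmp; exact: pQ.
Qed.

(** A strict inequality for the right derivative at [0] absorbs the error [o(h)]. *)
Lemma near_sum_transition_lt {R : realType} (p : R -> nat -> nat -> R)
    (q : nat -> nat -> R) (f : nat -> R) (i n : nat) (c : R) :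
  has_Q_matrix p q -> (i < n)%N -> \sum_(j < n) q i j * f j < c ->
  \forall h \near 0^'+, \sum_(j < n) p h i j * f j < f i + c * h.
Proof.
move=> pQ ltin qc; near=> h.
have h0 : 0 < h by [].
rewrite -ltrBlDl -ltr_pdivrMr//.
by near: h; apply: cvgr_lt qc; exact: cvg_sum_transition.
Unshelve. all: by end_near. Qed.

Lemma near_sum_transition_gt {R : realType} (p : R -> nat -> nat -> R)
    (q : nat -> nat -> R) (f : nat -> R) (i n : nat) (c : R) :
  has_Q_matrix p q -> (i < n)%N -> c < \sum_(j < n) q i j * f j ->
  \forall h \near 0^'+, f i + c * h < \sum_(j < n) p h i j * f j.
Proof.
move=> pQ ltin qc; near=> h.
have h0 : 0 < h by [].
rewrite -ltrBrDl -ltr_pdivlMr//.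
by near: h; apply: cvgr_gt qc; exact: cvg_sum_transition.
Unshelve. all: by end_near. Qed.

(** Row [i] is supported on the columns below [i.+2], and conservativity turns the diagonal entry
    into differences with [f i]. *)
Lemma sum_birth_death_Q {R : realType} (alpha beta f : nat -> R) (i : nat) :
  \sum_(j < i.+2) birth_death_Q alpha beta i j * f j =
  beta i * (f i.+1 - f i) +
  (if i is k.+1 then alpha i * (f k - f i) else 0).
Proof.
have ltii : (i < i.+2)%N by rewrite ltnW.
rewrite (bigD1 (Ordinal ltii))//= {1}/birth_death_Q eqxx mulNr mulr_suml.
have -> : \sum_(j < i.+2 | j != Ordinal ltii) birth_death_Q alpha beta i j * f j =
    \sum_(j < i.+2 | j != i :> nat) birth_death_rate alpha beta i j * f j.
  by apply: eq_bigr => j; rewrite -val_eqE/= /birth_death_Q => /negbTE ->.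
rewrite addrC -sumrB.
rewrite (eq_bigr (fun j : 'I__ => birth_death_rate alpha beta i j * (f j - f i)));
  last by move=> j _; rewrite mulrBr.
rewrite big_mkcond/= (eq_bigr (fun j : 'I_i.+2 =>
    birth_death_rate alpha beta i j * (f j - f i))); last first.
  by move=> j _; have [->|] := eqVneq (j : nat) i; rewrite ?subrr ?mulr0.
rewrite !big_ord_recr/= subrr mulr0 addr0 addrC /birth_death_rate eqxx; congr +%R.
case: i {ltii} => [|i]; first by rewrite big_ord0.
rewrite big_ord_recr/= eqxx (@ltn_eqF i i.+2)// big1 ?add0r// => j _.
have ji := ltn_ord j.
by rewrite !ifF ?mul0r//; lia.
Qed.

(** Tonelli: integrating [V'] against the mass moved by the kernel [k] amounts to integrating the
    one-step average of [V'] against [a]. *)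
Lemma series_transport {R : realType} (a : nat -> R) (a' : nat -> \bar R)
    (k : nat -> nat -> R) (V' : nat -> R) :
  (forall i, 0 <= a i) -> (forall i j, 0 <= k i j) -> (forall j, 0 <= V' j) ->
  (forall j, a' j = \sum_(0 <= i <oo) (a i * k i j)%:E)%E ->
  (\sum_(0 <= j <oo) a' j * (V' j)%:E =
   \sum_(0 <= i <oo) (a i)%:E * \sum_(0 <= j <oo) (k i j * V' j)%:E)%E.
Proof.
move=> a0 k0 V0 a'E.
transitivity (\sum_(0 <= j <oo) \sum_(0 <= i <oo)
    ((a i)%:E * (k i j * V' j)%:E))%E.
  apply: eq_eseriesr => j _.
  rewrite a'E muleC -nneseriesZl//; last first.
    by move=> i _; rewrite lee_fin mulr_ge0.
  by apply: eq_eseriesr => i _; rewrite -!EFinM; congr EFin; ring.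
rewrite nneseries_interchange; last first.
  by move=> j i; rewrite -EFinM lee_fin !mulr_ge0.
apply: eq_eseriesr => i _.
by rewrite nneseriesZl// => j _; rewrite lee_fin mulr_ge0.
Qed.

(** * The Markov property along a time grid *)

Lemma measure_fibers {d : measure_display} {T : measurableType d} {R : realType}
    (mu : {measure set T -> \bar R}) (A : set T) (N : T -> nat) :
  (forall n, measurable (A `&` N @^-1` [set n])) ->
  mu A = (\sum_(0 <= n <oo) mu (A `&` N @^-1` [set n]))%E.
Proof.
move=> mAN.
have AE : \bigcup_n (A `&` N @^-1` [set n]) = A.
  by apply/seteqP; split=> [w [n _ []]//|w Aw]; exists (N w).
rewrite -{1}AE measure_semi_bigcup//; last exact: bigcup_measurable.
by apply/trivIsetP => i j _ _ ij; apply/seteqP; split=> // w [[_ /= Ni] [_ /= Nj]];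
  rewrite -Ni Nj eqxx in ij.
Qed.

Section Grid.
Context {R : realType} {d : measure_display} {T : measurableType d}
  {P : probability T R} (X : R -> {RV P >-> nat}).
Variable h : R.

Definition grid_path (k : nat) (w : T) : seq nat :=
  [seq X (l%:R * h) w | l <- iota 0 k.+1].

Arguments grid_path : simpl never.

Lemma nth_grid_path k w l : (l <= k)%N -> nth 0%N (grid_path k w) l = X (l%:R * h) w.
Proof. by move=> lk; rewrite (nth_map 0%N) ?size_iota// nth_iota. Qed.

Lemma grid_pathS k w :
  grid_path k.+1 w = rcons (grid_path k w) (X (k.+1%:R * h) w).
Proof. by rewrite /grid_path -addn1 iotaD map_cat cats1. Qed.

Lemma last_grid_path k w x : last x (grid_path k w) = X (k%:R * h) w.
Proof. by case: k => [|k]//; rewrite grid_pathS last_rcons. Qed.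

Lemma measurable_RV_eq t i : measurable (X t @^-1` [set i]).
Proof. by rewrite -[X in measurable X]setTI; exact: measurable_funP. Qed.

Lemma grid_path_cylinder k (s : seq nat) : size s = k.+1 ->
  [set w | grid_path k w = s] =
  \bigcap_(l in `I_k.+1) (X (l%:R * h) @^-1` [set nth 0%N s l]).
Proof.
move=> sk; apply/seteqP; split=> w /=.
  by move=> <- l /= lk; rewrite /preimage/= nth_grid_path.
move=> ws; apply: (@eq_from_nth _ 0%N); first by rewrite size_map size_iota.
rewrite size_map size_iota => l lk.
by rewrite nth_grid_path//; apply: ws.
Qed.

Lemma measurable_grid_path_eq k s : measurable [set w | grid_path k w = s].
Proof.
have [sk|sk] := eqVneq (size s) k.+1.
  rewrite grid_path_cylinder//; apply: bigcap_measurable; first by exists 0%N.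
  by move=> l _; exact: measurable_RV_eq.
rewrite [X in measurable X](_ : _ = set0)//; apply/seteqP; split=> // w /= ws.
by move: sk; rewrite -ws size_map size_iota eqxx.
Qed.

(** Grid paths are countably many, coded by [pickle]; splitting an event along the code reduces it
    to single paths. *)
Lemma grid_path_fiber k (S : set (seq nat)) n :
  let F := [set w | S (grid_path k w)] `&`
    (fun w => pickle (grid_path k w)) @^-1` [set n] in
  F = set0 \/ exists2 s, S s & F = [set w | grid_path k w = s].
Proof.
move=> F.
have [[s [Ss sn]]|nS] := pselect (exists s : seq nat, S s /\ pickle s = n).
  right; exists s => //; apply/seteqP; split=> w.
    by move=> [_ wn]; apply: (pcan_inj pickleK); rewrite sn.
  by rewrite /F /= => ->; rewrite -sn.
left; apply/seteqP; split=> // w [Sw wn].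
by apply: nS; exists (grid_path k w).
Qed.

Lemma measurable_grid_path k (S : set (seq nat)) :
  measurable [set w | S (grid_path k w)].
Proof.
rewrite [X in measurable X](_ : _ = \bigcup_n
  ([set w | S (grid_path k w)] `&` (fun w => pickle (grid_path k w)) @^-1` [set n])).
  apply: bigcup_measurable => n _.
  by have [->//|[s _ ->]] := grid_path_fiber k S n; exact: measurable_grid_path_eq.
by apply/seteqP; split=> [w Sw|w [n _ []]//]; exists (pickle (grid_path k w)).
Qed.

(** The hypothesis speaks of cylinders. Summing it over the countably many pasts [s] in [S] that end
    at [i], all with the same factor [p h i j], gives an arbitrary past event. *)
Lemma markov_grid_path (p : R -> nat -> nat -> R) k (S : set (seq nat)) i j :
  0 < h -> markov_with_transition X p -> transition_function p ->
  P [set w | [/\ S (grid_path k w), X (k%:R * h) w = i & X (k.+1%:R * h) w = j]] =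
  (P [set w | S (grid_path k w) /\ X (k%:R * h) w = i] * (p h i j)%:E)%E.
Proof.
move=> h0 mX tp.
pose S1 s := S s /\ last 0%N s = i.
pose A := [set w | S1 (grid_path k w)].
pose N w := pickle (grid_path k w).
have mAn n : measurable (A `&` N @^-1` [set n]).
  by have [->//|[s _ ->]] := grid_path_fiber k S1 n; exact: measurable_grid_path_eq.
have AE w : A w <-> S (grid_path k w) /\ X (k%:R * h) w = i.
  by rewrite -(last_grid_path k w 0%N).
have mj := measurable_RV_eq (k.+1%:R * h) j.
rewrite [X in P X = _](_ : _ = A `&` X (k.+1%:R * h) @^-1` [set j]); last first.
  apply/seteqP; split=> w; rewrite /setI/preimage/mkset AE.
    by move=> [? ? <-].
  by move=> [[? ?] ?].
rewrite [X in (P X * _)%E](_ : _ = A); last first.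
  by apply/seteqP; split=> w; rewrite /mkset AE.
rewrite (measure_fibers P A N)// (measure_fibers P (A `&` _) N); last first.
  by move=> n; rewrite setIAC; exact: measurableI.
rewrite muleC -nneseriesZl//; apply: eq_eseriesr => n _.
rewrite setIAC.
have [->|[s [_ si] ->]] := grid_path_fiber k S1 n.
  by rewrite set0I measure0 mule0.
have [sk|sk] := eqVneq (size s) k.+1; last first.
  have -> : [set w | grid_path k w = s] = set0.
    apply/seteqP; split=> // w /= ws.
    by move: sk; rewrite -ws size_map size_iota eqxx.
  by rewrite set0I measure0 mule0.
(* The list [s] prescribes the states up to index [k]; index [k.+1] carries the new state [j]. *)
have := mX k (fun l => l%:R * h) (fun l => if l == k.+1 then j else nth 0%N s l).
rewrite mul0r lexx => /(_ isT)/=.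
have tinc l : (l <= k)%N -> l%:R * h < l.+1%:R * h.
  by move=> _; rewrite ltr_pM2r// ltr_nat.
move/(_ tinc).
rewrite eqxx ltn_eqF//.
have -> : k.+1%:R * h - k%:R * h = h by rewrite -mulrBl -natrB// subSnn mul1r.
have -> : nth 0%N s k = i by rewrite -si -nth_last sk.
have cylE : \bigcap_(l in `I_k.+1) (X (l%:R * h) @^-1`
      [set if l == k.+1 then j else nth 0%N s l]) =
    [set w | grid_path k w = s].
  rewrite grid_path_cylinder//; apply: eq_bigcapr => l /= lk.
  by rewrite ltn_eqF.
rewrite cylE => mXk; rewrite muleC -mXk; congr (P _).
rewrite -cylE; apply/seteqP; split=> w /=.
  move=> [ws wj] l /=; rewrite ltnS leq_eqVlt => /predU1P[->|lk].
    by rewrite eqxx.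
  exact: ws.
move=> ws; split=> [l /= lk|]; first by apply: ws => /=; exact: ltnW.
by have := ws k.+1 (ltnSn _); rewrite eqxx.
Qed.
End Grid.

(** * Excursions from 0 on a grid *)

(** Once off [0] the path stays off [0]; an initial stay at [0] is allowed. The extra [0] in front
    of [s] makes the first comparison vacuous. *)
Definition never_returns (s : seq nat) : bool :=
  (nth 0%N s 0 == 0%N) && path (fun a b => (a != 0%N) ==> (b != 0%N)) 0%N s.

Lemma never_returns_rcons (s : seq nat) (j : nat) : (0 < size s)%N ->
  never_returns (rcons s j) =
  never_returns s && ((last 0%N s != 0%N) ==> (j != 0%N)).
Proof. by move=> s0; rewrite /never_returns rcons_path nth_rcons s0 andbA. Qed.

(* State 0 stands for "has not left 0 yet": a path coming back to 0 is
   killed. *)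
Definition killed {R : realType} (p : R -> nat -> nat -> R) (h : R) (i j : nat) : R :=
  if (i != 0%N) && (j == 0%N) then 0 else p h i j.

Section Excursion.
Context {R : realType} {d : measure_display} {T : measurableType d}
  {P : probability T R} (X : R -> {RV P >-> nat}) (p : R -> nat -> nat -> R).
Variable h : R.
Hypothesis h0 : 0 < h.
Hypothesis tp : transition_function p.
Hypothesis mX : markov_with_transition X p.
Hypothesis X0 : P (X 0 @^-1` [set 0%N]) = 1%E.

Definition excursion_event k i : set T :=
  [set w | never_returns (grid_path X h k w) /\ X (k%:R * h) w = i].

Lemma measurable_excursion_event k i : measurable (excursion_event k i).
Proof.
apply: measurableI; last exact: measurable_RV_eq.
exact: (measurable_grid_path X h k [set s | never_returns s]).
Qed.

Definition excursion_mass k i : R := fine (P (excursion_event k i)).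

Lemma excursion_massE k i : (excursion_mass k i)%:E = P (excursion_event k i).
Proof.
by rewrite fineK// fin_num_measure//; exact: measurable_excursion_event.
Qed.

Lemma excursion_mass_ge0 k i : 0 <= excursion_mass k i.
Proof. by rewrite fine_ge0. Qed.

Lemma excursion_mass0 i : excursion_mass 0 i = (i == 0%N)%:R.
Proof.
have EE : excursion_event 0 i =
    (X 0 @^-1` [set 0%N] `&` X 0 @^-1` [set i]).
  apply/seteqP; split=> w; rewrite /excursion_event/= mul0r.
    by rewrite /never_returns/= mul0r => -[/andP[/eqP -> _] <-].
  by move=> [X00 Xi]; split=> //; rewrite /never_returns/= mul0r X00.
apply/EFin_inj; rewrite excursion_massE EE.
have [->|i0] := eqVneq i 0%N; first by rewrite setIid X0.
rewrite [X in P X](_ : _ = set0) ?measure0//.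
apply/seteqP; split=> // w [/= Xw0 Xwi].
by move: i0; rewrite -Xwi Xw0 eqxx.
Qed.

(** Forward equation of the chain killed at its return: decompose by the state at time [k * h]; a
    step from a nonzero state to [0] is excluded. *)
Lemma excursion_massS k j :
  (excursion_mass k.+1 j)%:E =
  (\sum_(0 <= i <oo) (excursion_mass k i * killed p h i j)%:E)%E.
Proof.
rewrite excursion_massE (measure_fibers P _ (X (k%:R * h))); last first.
  move=> i; apply: measurableI; first exact: measurable_excursion_event.
  exact: measurable_RV_eq.
apply: eq_eseriesr => i _; rewrite EFinM excursion_massE.
have step w : never_returns (grid_path X h k.+1 w) =
    never_returns (grid_path X h k w) &&
    ((X (k%:R * h) w != 0%N) ==> (X (k.+1%:R * h) w != 0%N)).
  by rewrite grid_pathS never_returns_rcons ?last_grid_path// size_map size_iota.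
rewrite /killed; case: ifPn => [/andP[i0 /eqP j0]|ij].
  rewrite mule0 (_ : _ `&` _ = set0) ?measure0//.
  apply/seteqP; split=> // w [[/= + Xj] Xi]; rewrite step Xj Xi i0 j0.
  by rewrite andbF.
rewrite -(markov_grid_path X h p k [set s | never_returns s])//.
apply: (congr1 P); apply/seteqP; split=> w.
  by move=> [[/= + Xj] Xi]; rewrite step => /andP[].
move=> [/= wn Xi Xj]; split=> //; split=> //; rewrite step wn Xi Xj.
by move: ij; case: (i != 0%N).
Qed.

Lemma never_returns_mass k :
  P [set w | never_returns (grid_path X h k w)] =
  (\sum_(0 <= i <oo) (excursion_mass k i)%:E)%E.
Proof.
rewrite (measure_fibers P _ (X (k%:R * h))).
  by apply: eq_eseriesr => i _; rewrite excursion_massE.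
by move=> i; exact: measurable_excursion_event.
Qed.

Let killed_ge0 i j : 0 <= killed p h i j.
Proof. by rewrite /killed; case: ifP => // _; apply: (transition_ge0 tp); exact: ltW. Qed.

Let initial_mass (V : nat -> R) : 0 <= V 0%N ->
  (\sum_(0 <= i <oo) (excursion_mass 0 i)%:E * (V i)%:E = (V 0%N)%:E)%E.
Proof.
move=> V0; rewrite (nneseries_split 0%N 1%N); last first.
  by move=> [|k] _; rewrite excursion_mass0/= -EFinM ?mul0r// mul1r lee_fin.
rewrite eseries0 ?adde0; last first.
  by move=> [|k]// _ _; rewrite excursion_mass0/= mul0e.
by rewrite big_nat1 excursion_mass0 mul1e.
Qed.

(** [V] is a supersolution of the killed backward equation, so the total of [V k] against
    [excursion_mass k] is nonincreasing in [k]. It starts at [V 0 0] and at [K] dominates the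
    surviving mass. *)
Lemma never_returns_le (V : nat -> nat -> R) (K : nat) :
  (forall k i, (k <= K)%N -> 0 <= V k i) ->
  (forall k i, (k < K)%N ->
    (\sum_(0 <= j <oo) (killed p h i j * V k.+1 j)%:E <= (V k i)%:E)%E) ->
  (forall i, 1 <= V K i) ->
  (P [set w | never_returns (grid_path X h K w)] <= (V 0 0)%:E)%E.
Proof.
move=> V0 VS VK; rewrite never_returns_mass -(initial_mass (V 0%N)) ?V0//.
apply: (@le_trans _ _ (\sum_(0 <= i <oo) (excursion_mass K i)%:E * (V K i)%:E)%E).
  apply: lee_nneseries => i *; first by rewrite lee_fin excursion_mass_ge0.
  by rewrite -EFinM lee_fin ler_peMr// excursion_mass_ge0.
elim: {-2}K (leqnn K) => // k IH kK.
apply: le_trans (IH (ltnW kK)).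
rewrite (series_transport (excursion_mass k) _ (killed p h))//; last first.
- exact: excursion_massS.
- by move=> j; exact: V0.
- exact: excursion_mass_ge0.
apply: lee_nneseries => i *.
  rewrite mule_ge0// ?lee_fin ?excursion_mass_ge0// nneseries_ge0// => j _ _.
  by rewrite lee_fin mulr_ge0// V0.
by rewrite lee_wpmul2l ?lee_fin ?excursion_mass_ge0// VS.
Qed.

(** Dually, a subsolution has a nondecreasing total, which at [K] is at most the surviving mass. *)
Lemma never_returns_ge (V : nat -> nat -> R) (K : nat) :
  (forall k i, (k <= K)%N -> 0 <= V k i) ->
  (forall k i, (k < K)%N ->
    ((V k i)%:E <= \sum_(0 <= j <oo) (killed p h i j * V k.+1 j)%:E)%E) ->
  (forall i, V K i <= 1) ->
  ((V 0 0)%:E <= P [set w | never_returns (grid_path X h K w)])%E.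
Proof.
move=> V0 VS VK; rewrite never_returns_mass -(initial_mass (V 0%N)) ?V0//.
apply: (@le_trans _ _ (\sum_(0 <= i <oo) (excursion_mass K i)%:E * (V K i)%:E)%E); last first.
  apply: lee_nneseries => i *; rewrite -EFinM lee_fin.
    by rewrite mulr_ge0 ?V0 ?excursion_mass_ge0.
  by rewrite ler_piMr// excursion_mass_ge0.
elim: {-2}K (leqnn K) => // k IH kK.
apply: le_trans (IH (ltnW kK)) _.
rewrite [leRHS](series_transport (excursion_mass k) _ (killed p h))//; last first.
- exact: excursion_massS.
- by move=> j; exact: V0.
- exact: excursion_mass_ge0.
apply: lee_nneseries => i *.
  by rewrite -EFinM lee_fin mulr_ge0 ?V0 ?excursion_mass_ge0// ltnW.
by rewrite lee_wpmul2l ?lee_fin ?excursion_mass_ge0// VS.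
Qed.

End Excursion.

(** * Bounds for one killed step through finitely many entries of a row *)

Section KilledStep.
Context {R : realType} (p : R -> nat -> nat -> R).
Variable h : R.
Hypothesis h0 : 0 <= h.
Hypothesis tp : transition_function p.

Let p0 i j : 0 <= p h i j. Proof. exact: transition_ge0. Qed.

Lemma killed_ge0 i j : 0 <= killed p h i j.
Proof. by rewrite /killed; case: ifP. Qed.

Lemma killed_le i j : killed p h i j <= p h i j.
Proof. by rewrite /killed; case: ifP. Qed.

Lemma transition_split i n :
  ((\sum_(j < n) p h i j)%:E + \sum_(n <= j <oo) (p h i j)%:E = 1)%E.
Proof.
rewrite -(transition_sum1 tp i h0) (nneseries_split 0%N n)//; last first.
  by move=> k _; rewrite lee_fin.
by rewrite add0n sumEFin big_mkord.
Qed.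

Lemma transition_partial_sum_le1 i n : \sum_(j < n) p h i j <= 1.
Proof.
rewrite -lee_fin -(transition_split i n) leeDl// nneseries_ge0// => j _ _.
by rewrite lee_fin.
Qed.

(** Columns from [n] on enter only through [W j <= 1] and the row sum [1]: their mass is [1] minus
    the partial sum of [p h i]. *)
Lemma killed_series_le (W : nat -> R) i n : (forall j, 0 <= W j <= 1) ->
  (\sum_(0 <= j <oo) (killed p h i j * W j)%:E <=
   (1 + \sum_(j < n) (killed p h i j * W j - p h i j))%:E)%E.
Proof.
move=> W01.
have KW j : 0 <= killed p h i j * W j.
  by rewrite mulr_ge0 ?killed_ge0//; case/andP: (W01 j).
rewrite (nneseries_split 0%N n); last by move=> k _; rewrite lee_fin.
rewrite add0n sumEFin big_mkord sumrB EFinD EFinB -(transition_split i n).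
rewrite addeAC addeCA subee// adde0.
rewrite leeD2l//; apply: lee_nneseries => j *; rewrite lee_fin//.
apply: le_trans (killed_le i j); rewrite ler_piMr// ?killed_ge0//.
by case/andP: (W01 j).
Qed.

Lemma killed_series_le1 (W : nat -> R) i : (forall j, 0 <= W j <= 1) ->
  (\sum_(0 <= j <oo) (killed p h i j * W j)%:E <= 1)%E.
Proof.
move=> W01; have := killed_series_le W i 0 W01.
by rewrite big_ord0 addr0.
Qed.

Lemma killed_series_ge (W : nat -> R) i n : (forall j, 0 <= W j) ->
  ((\sum_(j < n) killed p h i j * W j)%:E <=
   \sum_(0 <= j <oo) (killed p h i j * W j)%:E)%E.
Proof.
move=> W0; rewrite -(big_mkord xpredT (fun j => killed p h i j * W j)) -sumEFin.
by apply: nneseries_lim_ge => j *; rewrite lee_fin mulr_ge0 ?killed_ge0.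
Qed.

End KilledStep.

(** The value of [j] seen from [i]: a return to [0] from a nonzero state is worth nothing, whereas
    [f 0] is kept as the value before [0] is left. *)
Definition killed_value {R : realType} (f : nat -> R) (i j : nat) : R :=
  if (i != 0%N) && (j == 0%N) then 0 else f j.

(** * Survival probabilities bounded by comparison functions *)

Section Comparison.
Context {R : realType} {d : measure_display} {T : measurableType d}
  {P : probability T R} (X : R -> {RV P >-> nat}) (p : R -> nat -> nat -> R).
Context (alpha beta : nat -> R).
Let q := birth_death_Q alpha beta.
Hypothesis tp : transition_function p.
Hypothesis pq : has_Q_matrix p q.
Hypothesis mX : markov_with_transition X p.
Hypothesis X0 : P (X 0 @^-1` [set 0%N]) = 1%E.

(* The comparison function at time [k * h] is [Num.min 1 (k * h / t + U j)]
   below [N] and [1] from [N] on. *)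
Lemma near_never_returns_le (U : nat -> R) (N : nat) (t : R) : 0 < t ->
  (forall j, (j <= N)%N -> 0 <= U j) -> 1 <= U N ->
  (forall i, (i < N)%N ->
    \sum_(j < i.+2) q i j * killed_value U i j < - t^-1) ->
  \forall h \near 0^'+, forall K : nat, K%:R * h = t ->
    (P [set w | never_returns (grid_path X h K w)] <= (U 0%N)%:E)%E.
Proof.
move=> t0 U0 UN AU.
(* Since the rows of [q] sum to zero, the drift bound passes to [killed_value U i - 1], the form in
   which mass outside the row is counted with value [1]. *)
have Q0 i : \sum_(j < i.+2) q i j = 0.
  have := sum_birth_death_Q alpha beta (fun=> 1) i.
  under eq_bigr do rewrite mulr1.
  by move=> ->; rewrite /= subrr mulr0 add0r; case: i => // i; rewrite ?subrr mulr0.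
have step : \forall h \near 0^'+, forall i : 'I_N,
    \sum_(j < i.+2) p h i j * (killed_value U i j - 1) < U i - 1 - h / t.
  apply: filter_forall => i.
  have -> : U i - 1 = killed_value U i i - 1.
    by rewrite /killed_value; case: eqP => //= ->.
  have := @near_sum_transition_lt R p q (fun j => killed_value U i j - 1) i i.+2
    (- t^-1) pq.
  rewrite ltnW// => /(_ isT).
  under eq_bigr do rewrite mulrBr mulr1.
  rewrite sumrB Q0 subr0 => /(_ (AU i (ltn_ord i))).
  by apply: filterS => h; rewrite mulNr (mulrC _ h).
near=> h => K Kt.
have h0 : 0 < h by [].
pose V k j := if (j < N)%N then Order.min 1 (k%:R * h / t + U j) else 1.
have s0 k : 0 <= k%:R * h / t by rewrite divr_ge0 ?mulr_ge0 ?(ltW t0) ?(ltW h0).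

have V01 k j : 0 <= V k j <= 1.
  rewrite /V; case: ifP => jN; last by rewrite ler01 lexx.
  by rewrite le_min ler01 addr_ge0 ?U0 1?ltnW//= ge_min lexx.
have VU k j : (j <= N)%N -> V k j <= k%:R * h / t + U j.
  rewrite /V leq_eqVlt => /predU1P[->|->]; last by rewrite ge_min lexx orbT.
  by rewrite ltnn (le_trans UN)// lerDr.
apply: (@le_trans _ _ (V 0 0)%:E); last first.
  by rewrite lee_fin (le_trans (VU _ _ _))// mul0r mul0r add0r.
apply: (never_returns_le X p h h0 tp mX X0 V K).
- by move=> k i _; case/andP: (V01 k i).
- move=> k i kK.
  (* Where the comparison function equals [1] the inequality holds because it never exceeds [1]. *)
  have triv : V k i = 1 -> (\sum_(0 <= j <oo) (killed p h i j * V k.+1 j)%:E <=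
     (V k i)%:E)%E by move=> ->; exact: killed_series_le1 (ltW h0) tp _ _ (V01 _).
  have [iN|Ni] := ltnP i N; last by apply: triv; rewrite /V ltnNge Ni.
  have [le1|gt1] := leP 1 (k%:R * h / t + U i).
    by apply: triv; rewrite /V iN; apply/min_idPl.
  rewrite (_ : V k i = k%:R * h / t + U i); last first.
    by rewrite /V iN; apply/min_idPr/ltW.
  apply: (le_trans (killed_series_le p h (ltW h0) tp _ i i.+2 (V01 _))).
  rewrite lee_fin.
  have st : \sum_(j < i.+2) p h i j * (killed_value U i j - 1) < U i - 1 - h / t.
    suff /(_ (Ordinal iN)) : forall i : 'I_N,
      \sum_(j < i.+2) p h i j * (killed_value U i j - 1) < U i - 1 - h / t by [].
    by near: h.
  have le_step : \sum_(j < i.+2) (killed p h i j * V k.+1 j - p h i j) <=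
      \sum_(j < i.+2) p h i j * (killed_value U i j - 1) + k.+1%:R * h / t.
    apply: (@le_trans _ _ (\sum_(j < i.+2) (p h i j * (killed_value U i j - 1) +
        p h i j * (k.+1%:R * h / t)))).
      apply: ler_sum => j _.
      rewrite -mulrDr addrAC mulrDr mulrN1 lerD2r /killed /killed_value.
      have pij := transition_ge0 tp i j (ltW h0).
      case: ifP => _; first by rewrite mul0r add0r mulr_ge0.
      by rewrite ler_wpM2l// addrC VU// -ltnS (leq_trans (ltn_ord j)).
    rewrite big_split/= lerD2l -mulr_suml ler_piMl//.
    exact: transition_partial_sum_le1 (ltW h0) tp _ _.
  (* The time term grows by [h / t] in one step, exactly what the drift of [U] gives back. *)
  have : k.+1%:R * h / t = k%:R * h / t + h / t by rewrite -natr1 !mulrDl mul1r.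
  lra.
- move=> i; rewrite /V; case: ifP => // iN.
  by rewrite Kt divff ?gt_eqF// le_min lexx/= lerDl U0// ltnW.
Unshelve. all: by end_near. Qed.

(** With [lam] the time left after the step, the constant [eps * lam] has mean at most itself under
    a substochastic row, and [eps * h] pays for the drift. Columns from [i.+2] on are dropped, [W]
    being nonnegative. *)
Lemma killed_step_ge (w W : nat -> R) (h eps lam : R) (i : nat) :
  0 < h -> 0 <= eps -> 0 <= lam -> (forall j, 0 <= W j) ->
  (forall j, (j <= i.+1)%N -> w j - eps * lam <= W j) ->
  w i - eps * h < \sum_(j < i.+2) p h i j * killed_value w i j ->
  ((w i - eps * (lam + h))%:E <= \sum_(0 <= j <oo) (killed p h i j * W j)%:E)%E.
Proof.
move=> h0 eps0 lam0 W0 wW wi.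
apply: le_trans (killed_series_ge p h (ltW h0) tp W i i.+2 W0).
have le_step : \sum_(j < i.+2) p h i j * killed_value w i j - eps * lam <=
    \sum_(j < i.+2) killed p h i j * W j.
  apply: (@le_trans _ _ (\sum_(j < i.+2) p h i j * (killed_value w i j - eps * lam))).
    under [leRHS]eq_bigr do rewrite mulrBr.
    rewrite sumrB lerD2l lerN2 -mulr_suml ler_piMl ?mulr_ge0//.
    exact: transition_partial_sum_le1 (ltW h0) tp _ _.
  apply: ler_sum => j _; rewrite /killed /killed_value.
  have pij := transition_ge0 tp i j (ltW h0).
  case: ifP => _; first by rewrite mul0r sub0r mulrN oppr_le0 !mulr_ge0.
  by rewrite ler_wpM2l// wW// -ltnS.
by rewrite lee_fin; lra.
Qed.

(* The comparison function at time [k * h] is the positive part of the maximum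
   of [w1 j - e1 * (t - k * h)], for [j <= M] only, and of
   [w2 j - e2 * (t - k * h)]. The latter dominates at [M], where the former is
   cut off; both are nonpositive outside a finite set of states. *)
Lemma near_never_returns_ge (w1 w2 : nat -> R) (M L : nat) (e1 e2 t : R) :
  0 < t -> 0 < e1 -> 0 < e2 ->
  (forall j, (j <= M)%N -> w1 j <= 1) -> (forall j, w2 j <= 1) ->
  (forall i, (i < M)%N -> - e1 < \sum_(j < i.+2) q i j * killed_value w1 i j) ->
  (forall i, (0 < i < L)%N -> - e2 < \sum_(j < i.+2) q i j * killed_value w2 i j) ->
  w2 0%N <= 0 -> (forall i, (L <= i)%N -> w2 i <= 0) ->
  w1 M <= w2 M - e2 * t ->
  \forall h \near 0^'+, forall K : nat, K%:R * h = t ->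
    ((w1 0%N - e1 * t)%:E <= P [set w | never_returns (grid_path X h K w)])%E.
Proof.
move=> t0 e10 e20 w11 w21 Aw1 Aw2 w20 w2L w12.
have near_step (w : nat -> R) e n (C : pred nat) :
    (forall i, (i < n)%N -> C i -> - e < \sum_(j < i.+2) q i j * killed_value w i j) ->
    \forall h \near 0^'+, forall i : 'I_n, C i ->
    w i - e * h < \sum_(j < i.+2) p h i j * killed_value w i j.
  move=> Aw; apply: filter_forall => i.
  have [Ci|nCi] := boolP (C i); last by near=> h => //.
  have -> : w i = killed_value w i i by rewrite /killed_value; case: eqP => //= ->.
  have := @near_sum_transition_gt R p q (killed_value w i) i i.+2 (- e) pq.
  rewrite ltnW// => /(_ isT) /(_ (Aw i (ltn_ord i) Ci)).
  by apply: filterS => h; rewrite mulNr.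
have step1 : \forall h \near 0^'+, forall i : 'I_M, true ->
    w1 i - e1 * h < \sum_(j < i.+2) p h i j * killed_value w1 i j.
  by apply: (near_step _ _ _ xpredT) => i iM _; exact: Aw1.
have step2 : \forall h \near 0^'+, forall i : 'I_L, (0 < i)%N ->
    w2 i - e2 * h < \sum_(j < i.+2) p h i j * killed_value w2 i j.
  by apply: (near_step _ _ _ (fun i => (0 < i)%N)) => i iL i0; apply: Aw2; rewrite i0.
near=> h => K Kt.
have h0 : 0 < h by [].
pose V k j := Order.max 0 (Order.max
  (if (j <= M)%N then w1 j - e1 * (t - k%:R * h) else 0) (w2 j - e2 * (t - k%:R * h))).
have V0 k j : 0 <= V k j by rewrite /V le_max lexx.
have V1 k j : (j <= M)%N -> w1 j - e1 * (t - k%:R * h) <= V k j.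
  by move=> jM; rewrite /V jM !le_max lexx orbT.
have V2 k j : w2 j - e2 * (t - k%:R * h) <= V k j.
  by rewrite /V !le_max lexx !orbT.
have tk k : (k <= K)%N -> 0 <= t - k%:R * h.
  by move=> kK; rewrite subr_ge0 -Kt ler_pM2r// ler_nat.
apply: (@le_trans _ _ (V 0 0)%:E).
  by rewrite lee_fin (le_trans _ (V1 _ _ _))// mul0r subr0.
apply: (never_returns_ge X p h h0 tp mX X0 V K) => //.
- move=> k i kK.
  have tkS : t - k%:R * h = t - k.+1%:R * h + h by rewrite -natr1 mulrDl mul1r; ring.
  have case2 : ((w2 i - e2 * (t - k%:R * h))%:E <=
      \sum_(0 <= j <oo) (killed p h i j * V k.+1 j)%:E)%E.
    (* Where [w2] is nonpositive so is the left side, while [V] is nonnegative. *)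
    have triv : w2 i <= 0 -> ((w2 i - e2 * (t - k%:R * h))%:E <=
        \sum_(0 <= j <oo) (killed p h i j * V k.+1 j)%:E)%E.
      move=> w2i; apply: (@le_trans _ _ 0%E).
        by rewrite lee_fin subr_le0 (le_trans w2i)// mulr_ge0 ?(ltW e20) ?tk// ltnW.
      by apply: nneseries_ge0 => j *; rewrite lee_fin mulr_ge0// killed_ge0// ltW.
    have [i0|i0] := eqVneq i 0%N; first by apply: triv; rewrite i0.
    have [iL|Li] := ltnP i L; last by apply: triv; exact: w2L.
    rewrite tkS; apply: killed_step_ge => //; [exact: ltW|exact: tk|].
    have {}i0 : (0 < i)%N by rewrite lt0n.
    suff H : forall i : 'I_L, (0 < i)%N ->
        w2 i - e2 * h < \sum_(j < i.+2) p h i j * killed_value w2 i j.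
      exact: H (Ordinal iL) i0.
    by near: h.
  have case1 : (i <= M)%N -> ((w1 i - e1 * (t - k%:R * h))%:E <=
      \sum_(0 <= j <oo) (killed p h i j * V k.+1 j)%:E)%E.
    rewrite leq_eqVlt => /predU1P[iM|iM].
      (* At [M] the next step may leave the range of the first function; by the hypothesis [w12] the
         second is already at least as large there. *)
      apply: le_trans case2; rewrite lee_fin iM.
      have := tk k (ltnW kK).
      have : e2 * (t - k%:R * h) <= e2 * t.
        by rewrite ler_pM2l// gerBl mulr_ge0 ?(ltW h0).
      have : 0 <= e1 * (t - k%:R * h) by rewrite mulr_ge0 ?(ltW e10) ?tk// ltnW.
      lra.
    rewrite tkS; apply: killed_step_ge => //; [exact: ltW|exact: tk| |].
      by move=> j ji; apply: V1; exact: leq_trans ji iM.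
    suff H : forall i : 'I_M, true ->
        w1 i - e1 * h < \sum_(j < i.+2) p h i j * killed_value w1 i j.
      exact: H (Ordinal iM) isT.
    by near: h.
  have case0 : (0 <= \sum_(0 <= j <oo) (killed p h i j * V k.+1 j)%:E)%E.
    by apply: nneseries_ge0 => j *; rewrite lee_fin mulr_ge0// killed_ge0// ltW.
  rewrite {1}/V !EFin_max !ge_max case0 case2 andbT/=.
  by case: ifP => // iM; exact: case1.
- move=> i; rewrite /V Kt subrr !mulr0 !subr0 !ge_max ler01 w21 andbT/=.
  by case: ifP => // iM; exact: w11.
Unshelve. all: by end_near. Qed.

End Comparison.

(** * The return time and its grid approximations *)

Lemma near_at_right {R : realType} (Q : R -> Prop) (x : R) :
  (\forall y \near x^'+, Q y) -> exists2 e, 0 < e & forall y, x < y < x + e -> Q y.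
Proof.
move=> /nbhs_ballP[e /= e0 xeQ]; exists e => // y /andP[xy yxe].
apply: xeQ => //; rewrite /ball/= distrC ger0_norm ?subr_ge0 ?ltW//.
by rewrite ltrBlDl.
Qed.

Lemma near_mesh {R : realType} (Q : R -> Prop) (t : R) : 0 < t ->
  (\forall h \near 0^'+, Q h) ->
  exists K0 : nat, forall K : nat, (K0 <= K)%N -> Q (t / K.+1%:R).
Proof.
move=> t0 /near_at_right[e e0 eQ]; exists (Num.truncn (t / e)) => K K0K.
apply: eQ; rewrite divr_gt0//= add0r ltr_pdivrMr// mulrC -ltr_pdivrMr//.
by rewrite (lt_le_trans (truncnS_gt _))// ler_nat.
Qed.

Section ReturnTime.
Context {R : realType} {d : measure_display} {T : measurableType d}
  {P : probability T R} (X : R -> {RV P >-> nat}).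

(** A grid step from a nonzero state to [0] exhibits a jump no later than [l * h] and a visit to [0]
    at [l.+1 * h], hence a return no later than [K * h]. *)
Lemma never_returns_of_return_time (h : R) (K : nat) (w : T) :
  0 < h -> X 0 w = 0%N -> ((K%:R * h)%:E < return_time0 X w)%E ->
  never_returns (grid_path X h K w).
Proof.
move=> h0 Xw0 Kw; apply/andP; split.
  by rewrite nth_grid_path// mul0r Xw0.
apply/(pathP 0%N) => -[//|l]; rewrite size_map size_iota ltnS => lK.
change (nth 0%N (0%N :: grid_path X h K w) l.+1) with
  (nth 0%N (grid_path X h K w) l).
rewrite !nth_grid_path//; last exact: ltnW.
apply/implyP => Xl; apply/negP => /eqP Xl1.
move: Kw; apply/negP; rewrite -leNgt.
apply: (@le_trans _ _ (l.+1%:R * h)%:E); last by rewrite lee_fin ler_pM2r// ler_nat.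
apply: ereal_inf_lbound; exists (l.+1%:R * h) => //; split=> //.
apply: (@le_lt_trans _ _ (l%:R * h)%:E); last by rewrite lte_fin ltr_pM2r// ltr_nat.
apply: ereal_inf_lbound; exists (l%:R * h) => //; split; first by rewrite mulr_ge0// ltW.
by rewrite Xw0; apply/eqP.
Qed.

(** By right continuity the path is off [0] just after some [u], and at [0] just after some later
    [v < t]; a fine mesh has points in both intervals. *)
Lemma returns_on_fine_mesh (t : R) (w : T) :
  right_continuous_paths X -> X 0 w = 0%N -> 0 < t ->
  (return_time0 X w < t%:E)%E ->
  exists K0 : nat, forall K : nat, (K0 <= K)%N ->
    ~~ never_returns (grid_path X (t / K.+1%:R) K.+1 w).
Proof.
move=> Xrc Xw0 t0 /ereal_inf_lt[_ [v [fv Xv] <-]]; rewrite lte_fin => vt.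
move: fv => /ereal_inf_lt[_ [u [u0 Xu] <-]]; rewrite lte_fin => uv.
have v0 : 0 <= v by rewrite (le_trans u0)// ltW.
have [eu eu0 Xeu] := near_at_right _ _ (Xrc u w u0).
have [ev ev0 Xev] := near_at_right _ _ (Xrc v w v0).
have : \forall h \near (0 : R)^'+, [/\ 0 < h, h < eu, h < ev, h < v - u & h < t - v].
  near=> h; split.
  - by [].
  - by near: h; exact: nbhs_right_lt.
  - by near: h; exact: nbhs_right_lt.
  - by near: h; apply: nbhs_right_lt; rewrite subr_gt0.
  - by near: h; apply: nbhs_right_lt; rewrite subr_gt0.
move=> /(near_mesh _ _ t0)[K0 HK]; exists K0 => K /HK.
set h := t / K.+1%:R => -[h0 heu hev huv hvt].
have next (x : R) : 0 <= x ->
    x < (Num.truncn (x / h)).+1%:R * h <= x + h.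
  move=> x0; rewrite -ltr_pdivrMr// truncnS_gt/= -natr1 mulrDl mul1r lerD2r.
  rewrite -ler_pdivlMr//.
  by case/andP: (truncn_itv (divr_ge0 x0 (ltW h0))).
have /andP[ul lu] := next u u0; have /andP[vl lv] := next v v0.
set a := (Num.truncn (u / h)).+1 in ul lu; set b := (Num.truncn (v / h)).+1 in vl lv.
have Xa : X (a%:R * h) w != 0%N.
  by rewrite Xeu -?Xw0; [exact/eqP | rewrite ul/= (le_lt_trans lu)// ltrD2l].
have Xb : X (b%:R * h) w = 0%N.
  by rewrite Xev// vl/= (le_lt_trans lv)// ltrD2l.
have ab : (a < b)%N.
  by rewrite -(ltr_nat R) -(ltr_pM2r h0) (le_lt_trans lu)// (lt_trans _ vl)// -ltrBrDl.
have Kh : K.+1%:R * h = t by rewrite /h mulrCA divff ?mulr1.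
have bK : (b <= K.+1)%N.
  rewrite -(ler_nat R) -(ler_pM2r h0) Kh.
  by rewrite (le_trans lv)// -lerBrDl ltW.
clearbody a b; apply/negP => /andP[_ /path_sorted srt].
(* The relation between neighbours is transitive, so it extends to the indices [a < b]. *)
have etr : transitive (fun a b : nat => (a != 0%N) ==> (b != 0%N)).
  by move=> [|y] [|x] [|z].
have := @sorted_ltn_nth _ _ etr 0%N _ srt a b.
rewrite !inE size_map size_iota !ltnS bK (leq_trans (ltnW ab) bK) => /(_ isT isT ab).
by rewrite !nth_grid_path ?(leq_trans (ltnW ab) bK)// Xa Xb.
Unshelve. all: by end_near. Qed.

Let G (t : R) (K : nat) : set T :=
  [set w | never_returns (grid_path X (t / K.+1%:R) K.+1 w)].

Let mG t K : measurable (G t K).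
Proof. exact: (measurable_grid_path X _ _ [set s | never_returns s]). Qed.

Hypothesis X0 : P (X 0 @^-1` [set 0%N]) = 1%E.

Let X0C : P (~` (X 0 @^-1` [set 0%N])) = 0%E.
Proof.
by have := probability_setC P (measurable_RV_eq X 0 0%N); rewrite X0 subee.
Qed.

Let mesh t K : (K.+1%:R : R) * (t / K.+1%:R) = t.
Proof. by rewrite mulrCA divff ?mulr1. Qed.

(** Measurability of [return_time0 X] is not established, so the event is enclosed in a measurable
    set: the grid event of one fine mesh, together with the null set of paths not starting at
    [0]. *)
Lemma return_time_tail_le (t c : R) : 0 < t ->
  (\forall h \near 0^'+, forall K : nat, K%:R * h = t ->
    (P [set w | never_returns (grid_path X h K w)] <= c%:E)%E) ->
  exists B : set T, [/\ measurable B,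
    [set w | (t%:E < return_time0 X w)%E] `<=` B & (P B <= c%:E)%E].
Proof.
move=> t0 /(near_mesh _ _ t0)[K /(_ K (leqnn K)) GK].
have mX0 := measurable_RV_eq X 0 0%N.
exists (G t K `|` ~` (X 0 @^-1` [set 0%N])); split.
- by apply: measurableU => //; exact: measurableC.
- move=> w tw; have [Xw|Xw] := pselect (X 0 w = 0%N); last by right.
  left; apply: never_returns_of_return_time => //; first by rewrite divr_gt0.
  by rewrite mesh.
- apply: le_trans (measureU2 _ _ _) _ => //; first exact: measurableC.
  rewrite [X in (_ + X)%E](_ : _ = 0%E) ?adde0//.
  by apply: GK; rewrite mesh.
Qed.

(** The set is the limit superior of the grid events, up to a null set: a path returning before [t]
    is outside these events for all fine meshes, and a lower bound for eventually all of them passes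
    to the limit superior. *)
Lemma return_time_tail_ge (t c : R) : 0 < t -> right_continuous_paths X ->
  (\forall h \near 0^'+, forall K : nat, K%:R * h = t ->
    (c%:E <= P [set w | never_returns (grid_path X h K w)])%E) ->
  exists B : set T, [/\ measurable B,
    B `<=` [set w | (t%:E <= return_time0 X w)%E] & (c%:E <= P B)%E].
Proof.
move=> t0 Xrc /(near_mesh _ _ t0)[K0 GK].
have mX0 := measurable_RV_eq X 0 0%N.
have mL : measurable (lim_sup_set (G t)).
  apply: bigcap_measurable; first by exists 0%N.
  by move=> n _; apply: bigcup_measurable => k _.
exists (lim_sup_set (G t) `&` X 0 @^-1` [set 0%N]); split.
- exact: measurableI.
- move=> w [Lw Xw0] /=; rewrite leNgt; apply/negP => tw.
  have [K1 HK] := returns_on_fine_mesh t w Xrc Xw0 t0 tw.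
  by have [k /= K1k] := Lw K1 I; apply/negP; exact: HK.
- have -> : P (lim_sup_set (G t) `&` X 0 @^-1` [set 0%N]) = P (lim_sup_set (G t)).
    rewrite -[in RHS](setIT (lim_sup_set (G t))) -(setUv (X 0 @^-1` [set 0%N])) setIUr.
    rewrite measureU//; last 3 first.
    + exact: measurableI.
    + by apply: measurableI => //; exact: measurableC.
    + by rewrite setIACA setICr setI0.
    rewrite [X in _ = (_ + X)%E](_ : _ = 0%E) ?adde0//.
    apply/eqP; rewrite -measure_le0 -X0C.
    apply: le_measure; rewrite ?inE//; first apply: measurableI => //.
    all: try exact: measurableC.
  (* The unions over [k >= n] decrease to the limit superior, and each contains [G t n]. *)
  have cvgL := @lim_sup_set_cvg _ _ _ P (G t) (mG t).
  rewrite -(cvg_lim _ (cvgL _))//; last first.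
    rewrite (le_lt_trans (probability_le1 _ _)) ?ltry//.
    exact: bigcup_measurable.
  apply: lime_ge; first by apply/cvg_ex; eexists; apply: cvgL;
    rewrite (le_lt_trans (probability_le1 _ _)) ?ltry//; exact: bigcup_measurable.
  exists K0 => // n /= K0n.
  apply: (@le_trans _ _ (P (G t n))); first by apply: (GK n K0n); rewrite mesh.
  apply: le_measure; rewrite ?inE//; first exact: bigcup_measurable.
  by move=> w Gw; exists n => /=.
Qed.

End ReturnTime.

(** * Scale function and tail bounds *)

Section Scale.
Context {R : realType} (alpha beta : nat -> R).

(** Increments of the function harmonic off [0], normalised by [beta 0 * scale_step 0 = 1]. *)
Definition scale_step (j : nat) : R :=
  \prod_(k < j) (alpha k.+1 / beta k.+1) / beta 0%N.

Definition scale (n : nat) : R := \sum_(j < n) scale_step j.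

(** This equals the product of [beta j / alpha j.+1] over [j < k]: the invariant measure with mass
    [1] at [0]. *)
Definition speed (k : nat) : R := (beta k * scale_step k)^-1.

Hypothesis alpha0 : forall n, 0 < alpha n.+1.
Hypothesis beta0 : forall n, 0 < beta n.

Lemma scale_step_gt0 j : 0 < scale_step j.
Proof. by rewrite divr_gt0// prodr_gt0// => k _; rewrite divr_gt0. Qed.

(** This is harmonicity of [scale] at [j.+1]. *)
Lemma scale_stepS j : beta j.+1 * scale_step j.+1 = alpha j.+1 * scale_step j.
Proof.
rewrite /scale_step big_ord_recr/=; field.
by rewrite !gt_eqF.
Qed.

Lemma scaleS n : scale n.+1 = scale n + scale_step n.
Proof. by rewrite /scale big_ord_recr. Qed.

Lemma scale1 : scale 1 = (beta 0%N)^-1.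
Proof. by rewrite /scale big_ord1 /scale_step big_ord0 mul1r. Qed.

Lemma scale_ge0 n : 0 <= scale n.
Proof. by apply: sumr_ge0 => j _; exact/ltW/scale_step_gt0. Qed.

Lemma scale_gt0 n : (0 < n)%N -> 0 < scale n.
Proof.
by case: n => // n _; rewrite scaleS ltr_wpDl ?scale_ge0 ?scale_step_gt0.
Qed.

Lemma le_scale n k : (n <= k)%N -> scale n <= scale k.
Proof.
move=> /subnKC <-; elim: (k - n)%N => [|l IH]; first by rewrite addn0.
by rewrite addnS scaleS (le_trans IH)// lerDl ltW ?scale_step_gt0.
Qed.

Lemma speed_gt0 k : 0 < speed k.
Proof. by rewrite invr_gt0 mulr_gt0 ?scale_step_gt0. Qed.

Context {d : measure_display} {T : measurableType d} {P : probability T R}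
  (X : R -> {RV P >-> nat}).
Hypothesis hX : is_Markov_chain X (birth_death_Q alpha beta) 0%N.

(** The bound is the value at [0] of a comparison function: twice the normalised scale, minus a
    correction creating a constant negative drift, plus, at [0], the mean holding time [1 / beta 0]
    times [2 / t]. *)
Lemma return_time_tail_le_scale (t : R) (N : nat) : 0 < t -> (0 < N)%N ->
  2 * scale N * (\sum_(k < N) speed k) <= t ->
  exists B : set T, [/\ measurable B,
    [set w | (t%:E < return_time0 X w)%E] `<=` B &
    (P B <= (2 / (beta 0%N * scale N) + 2 / (beta 0%N * t))%:E)%E].
Proof.
move=> t0 N0 Nt; have [_ X0 [p [tp pq mX]]] := hX.
apply: return_time_tail_le => //.
(* Off 0, the generator (killed at 0) maps [u] to the constant [- 2 / t]. *)
pose S j := \sum_(k < j) speed k.+1.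
pose u n := \sum_(j < n) scale_step j * (2 / scale N - 2 / t * S j).
(* The value at [0] is such that [beta 0 * (U 1 - U 0) = - 2 / t]. *)
pose U n := if n is 0%N then u 1%N + 2 / (beta 0%N * t) else u n.
have sN := scale_gt0 N N0.
have uS n : u n.+1 = u n + scale_step n * (2 / scale N - 2 / t * S n).
  by rewrite /u big_ord_recr.
(* The hypothesis on [t] lets the correction use at most half of the slope factor [2 / scale N], so
   [u] dominates [scale / scale N] and reaches [1] at [N]. *)
have SN j : (j < N)%N -> (scale N)^-1 <= 2 / scale N - 2 / t * S j.
  move=> jN.
  have Sj : 2 * scale N * S j <= t.
    apply: le_trans Nt; rewrite ler_wpM2l ?mulr_ge0 ?(ltW sN)//.
    have -> : S j = \sum_(k < j.+1) speed k - speed 0%N.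
      by rewrite big_ord_recl addrC addKr.
    rewrite lerBlDr; apply: (@le_trans _ _ (\sum_(k < N) speed k)); last first.
      by rewrite lerDl ltW ?speed_gt0.
    rewrite -!(big_mkord xpredT speed) (@big_cat_nat _ _ _ j.+1 0 N)//= lerDl.
    by apply: sumr_ge0 => k _; exact/ltW/speed_gt0.
  have : 2 / t * S j <= (scale N)^-1.
    by rewrite mulrAC ler_pdivrMr// ler_pdivlMl// mulrA (mulrC (scale N)).
  lra.
have u_ge n : (n <= N)%N -> scale n / scale N <= u n.
  elim: n => [|n IH] nN; first by rewrite /u /scale !big_ord0 mul0r.
  rewrite uS scaleS mulrDl lerD ?IH 1?ltnW//.
  by rewrite ler_pM2l ?scale_step_gt0// SN.
have U0E : U 0%N = 2 / (beta 0%N * scale N) + 2 / (beta 0%N * t).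
  rewrite /U /u big_ord1 /S big_ord0 mulr0 subr0 /scale_step big_ord0; congr +%R.
  by field; rewrite !gt_eqF.
rewrite -U0E; apply: (near_never_returns_le X p alpha beta tp pq mX X0 U N t) => //.
- move=> j jN; case: j jN => [|j] jN.
    by rewrite U0E addr_ge0// divr_ge0// mulr_ge0// ltW.
  by apply: le_trans (u_ge _ jN); rewrite divr_ge0 ?scale_ge0.
- have -> : U N = u N by rewrite /U; case: (N) N0.
  by rewrite (le_trans _ (u_ge N _))// divff// gt_eqF.
- move=> i iN; rewrite sum_birth_death_Q.
  (* The drift is exactly [- 2 / t]; the factor [2] makes the required bound strict. *)
  suff -> : beta i * (killed_value U i i.+1 - killed_value U i i) +
      match i with
      | 0%N => 0
      | k.+1 => alpha i * (killed_value U i k - killed_value U i i)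
      end = - (2 / t).
    by rewrite ltrN2 mulrC ltr_pMr ?invr_gt0// ltr1n.
  case: i iN => [|i] iN.
    by rewrite /killed_value/= addr0; field; rewrite !gt_eqF.
  have -> : killed_value U i.+1 i = u i.
    by rewrite /killed_value; case: i {iN} => //=; rewrite /u big_ord0.
  rewrite /killed_value /=.
  rewrite (uS i.+1) (uS i) addrAC subrr add0r.
  have -> : forall a b : R, a - (a + b) = - b by move=> a b; ring.
  rewrite mulrN (mulrA (beta _)) (mulrA (alpha _)) -scale_stepS -mulrBr.
  rewrite /S big_ord_recr/=.
  have -> : forall a b c e : R, a - b * (c + e) - (a - b * c) = - (b * e).
    by move=> *; ring.
  rewrite /speed mulrN mulrCA divff ?mulr1//.
  by rewrite mulf_neq0// ?gt_eqF ?scale_step_gt0.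
Qed.

End Scale.

(** * Lower tail bound for the linear growth model *)

Section LinearGrowth.
Context {R : realType} {d : measure_display} {T : measurableType d}
  {P : probability T R} (X : R -> {RV P >-> nat}) (m r s : R).
Hypotheses (m0 : 0 < m) (r0 : 0 <= r) (s0 : 0 < s) (rs : r <= s).
Hypothesis hX : is_Markov_chain X (linear_growth_Q m r m s) 0%N.
Local Notation alpha := (fun n : nat => m * n%:R + r).
Local Notation beta := (fun n : nat => m * n%:R + s).

Lemma alpha_gt0 n : 0 < alpha n.+1.
Proof. by rewrite ltr_wpDr// mulr_gt0. Qed.

Lemma beta_gt0 n : 0 < beta n.
Proof. by rewrite ltr_wpDl// mulr_ge0// ltW. Qed.

(** For [0 < i < 2 M] the generator at the parabola [i (2 M - i) / M ^ 2] is at least [- c / M]: the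
    first summand bounds the drift beyond [M], the second comes from [i <= 2 M], the rest from
    [1 <= M]. *)
Definition growth_constant : R := 2 * (s - r) + 4 * m + s + r.
Local Notation c := growth_constant.

Lemma growth_constant_gt0 : 0 < c.
Proof. by rewrite /c; have := m0; have := r0; have := s0; have := rs; lra. Qed.

(** Below [M] the comparison function is the normalised scale, halved so as to meet the parabola at
    [M] after the latter has lost [1/2] over time [t]. *)
Lemma return_time_tail_ge_scale (M : nat) : (0 < M)%N ->
  exists B : set T, [/\ measurable B,
    B `<=` [set w | ((M%:R / (4 * c))%:E <= return_time0 X w)%E] &
    ((4 * s * scale alpha beta M)^-1%:E <= P B)%E].
Proof.
move=> M0; have [Xrc X0 [p [tp pq mX]]] := hX.
have c0 := growth_constant_gt0.
have M1 : 1 <= M%:R :> R by rewrite ler1n.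
have Mr0 : 0 < M%:R :> R by rewrite ltr0n.
set t := M%:R / (4 * c).
have t0 : 0 < t by rewrite divr_gt0// mulr_gt0.
apply: return_time_tail_ge => //.
have sM : 0 < scale alpha beta M := scale_gt0 alpha beta alpha_gt0 beta_gt0 M M0.
(* Taking [w1 0 = w1 1] makes the generator vanish at [0] as well. *)
pose w1 j := if j is 0%N then scale alpha beta 1 / (2 * scale alpha beta M)
  else scale alpha beta j / (2 * scale alpha beta M).
pose w2 (j : nat) : R := j%:R * (2 * M%:R - j%:R) / M%:R ^+ 2.
have w10 : 0 < w1 0%N.
  by rewrite divr_gt0 ?mulr_gt0// (scale_gt0 alpha beta alpha_gt0 beta_gt0 1).
(* [w1] has zero drift but a strict inequality is required; half of [w1 0] is given up for it. *)
pose e1 := w1 0%N / (2 * t).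
have -> : (4 * s * scale alpha beta M)^-1 = w1 0%N - e1 * t.
  rewrite /e1 /w1 scale1 mulr0 add0r; field.
  by rewrite !gt_eqF.
have le_half j : (j <= M)%N -> scale alpha beta j / (2 * scale alpha beta M) <= 1.
  move=> jM; rewrite ler_pdivrMr ?mulr_gt0// mul1r.
  apply: (le_trans (le_scale alpha beta alpha_gt0 beta_gt0 j M jM)).
  by rewrite ler_peMl ?ler1n// ltW.
(* The loss rate [(2 * t)^-1] equals [2 * c / M], twice the bound on the drift of the parabola, and
   costs [1/2] over time [t]. *)
apply: (near_never_returns_ge X p alpha beta tp pq mX X0 w1 w2 M (2 * M) e1 (2 * t)^-1 t) => //.
- by rewrite divr_gt0// mulr_gt0.
- by rewrite invr_gt0 mulr_gt0.
- by move=> [|j] jM; apply: le_half => //.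
- move=> j; rewrite /w2 ler_pdivrMr ?exprn_gt0// mul1r.
  by have := sqr_ge0 (M%:R - j%:R : R); rewrite sqrrB; nra.
- move=> i iM; rewrite sum_birth_death_Q.
  apply: (@lt_le_trans _ _ 0); first by rewrite oppr_lt0 divr_gt0// mulr_gt0.
  case: i iM => [|i] iM.
    by rewrite /killed_value/= subrr mulr0 addr0.
  have -> : killed_value w1 i.+1 i = scale alpha beta i / (2 * scale alpha beta M).
    by rewrite /killed_value; case: i {iM} => //=; rewrite /scale big_ord0 mul0r.
  have := scale_stepS alpha beta beta_gt0 i.
  rewrite /killed_value /= !scaleS => stepS.
  rewrite -!mulrBl !mulrA -mulrDl.
  have -> : forall x y z : R, x + y + z - (x + y) = z by move=> *; ring.
  have -> : forall x y : R, x - (x + y) = - y by move=> *; ring.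
  by rewrite stepS mulrN subrr mul0r.
- move=> i /andP[i0 iM]; rewrite sum_birth_death_Q.
  case: i i0 iM => // i _ iM.
  have -> : killed_value w2 i.+1 i = w2 i.
    by rewrite /killed_value; case: i {iM} => //=; rewrite /w2 mul0r mul0r.
  rewrite /killed_value /= /w2.
  have iM' : i.+1%:R <= 2 * M%:R :> R by rewrite -natrM ler_nat ltnW.
  have i0' : 0 <= i%:R :> R by [].
  set D := (X in _ < X).
  have -> : D = (2 * (M%:R - i.+1%:R) * (s - r) - (2 * m * i.+1%:R + s + r)) / M%:R ^+ 2.
    by rewrite /D -!natr1; field; rewrite gt_eqF.
  have -> : - (2 * t)^-1 = (- (2 * c * M%:R)) / M%:R ^+ 2.
    by rewrite /t; field; rewrite !gt_eqF.
  rewrite ltr_pM2r ?invr_gt0 ?exprn_gt0//.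
  have := m0; have := r0; have := s0; have := rs.
  rewrite /c; move: iM' i0' M1; rewrite -natr1; nra.
- by rewrite /w2 mul0r mul0r.
- move=> i iM; rewrite /w2 pmulr_lle0 ?invr_gt0 ?exprn_gt0//.
  by rewrite mulr_ge0_le0// subr_le0 -natrM ler_nat.
- have -> : w1 M = 2^-1.
    by rewrite /w1; case: (M) M0 sM => // n _ sn; field; rewrite gt_eqF.
  have -> : w2 M - (2 * t)^-1 * t = 2^-1 by rewrite /w2; field; rewrite !gt_eqF.
  exact: lexx.
Qed.

End LinearGrowth.

(** * Integrals from tails at geometric scales *)

Section TailIntegral.
Context {R : realType} {d : measure_display} {T : measurableType d}
  (P : probability T R) (F : T -> \bar R).
Local Open Scope ereal_scope.
Hypothesis F0 : forall w, 0 <= F w.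

(** The integral of a nonnegative function is a supremum over simple functions below it, hence
    monotone on arbitrary nonnegative functions, such as those of [return_time0 X]. *)
Lemma le_integral_nonmeasurable (f g : T -> \bar R) :
  (forall w, 0 <= f w) -> (forall w, f w <= g w) ->
  \int[P]_w f w <= \int[P]_w g w.
Proof.
move=> f0 fg; rewrite !ge0_integralTE//; last by move=> w; exact: le_trans (fg w).
apply: ereal_sup_le => _ [h hf <-]; exists h => // w.
exact: le_trans (hf w) (fg w).
Qed.

Let mindic (a : R) (A : set T) : measurable A ->
  measurable_fun [set: T] ((fun w => a%:E * (\1_A w)%:E) : T -> \bar R).
Proof.
move=> mA; apply: measurable_funeM; apply/measurable_EFinP.
exact: measurable_indic.
Qed.

Let int_indic (a : R) (A : set T) : (0 <= a)%R -> measurable A ->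
  \int[P]_w (a%:E * (\1_A w)%:E) = a%:E * P A.
Proof.
move=> a0 mA; rewrite ge0_integralZl_EFin//.
  by rewrite integral_indic// setIT.
by apply/measurable_EFinP; exact: measurable_indic.
Qed.

(* With [l] the last index such that [w] is in [B l], [F w] is at most the
   [l]-th term of the series [C * rho ^+ k * \1_(B k) w]. *)
Lemma integral_lt_pinfty_tail (B : nat -> set T) (C D rho q : R) :
  (0 < C)%R -> (1 <= rho)%R -> (0 < q)%R -> (rho * q < 1)%R ->
  B 0%N = [set: T] -> (forall k, measurable (B k)) ->
  (forall k, P (B k) <= (D * q ^+ k)%:E) ->
  (forall k w, ~ B k.+1 w -> F w <= (C * rho ^+ k)%:E) ->
  \int[P]_w F w < +oo.
Proof.
move=> C0 rho1 q0 rq B0 mB PB FB.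
have rho0 : (0 < rho)%R by exact: lt_le_trans rho1.
have term0 k w : 0 <= (C * rho ^+ k)%:E * (\1_(B k) w)%:E :> \bar R.
  by rewrite -EFinM lee_fin !mulr_ge0// ?exprn_ge0// ltW.
have D0 : (0 <= D)%R.
  by have := le_trans (measure_ge0 P (B 0%N)) (PB 0%N); rewrite expr0 mulr1 lee_fin.
apply: (@le_lt_trans _ _ (\int[P]_w
    \sum_(0 <= k <oo) (C * rho ^+ k)%:E * (\1_(B k) w)%:E)).
  apply: le_integral_nonmeasurable => // w.
  have partial n := @nneseries_lim_ge R _ xpredT 0%N n (fun k _ _ => term0 k w).
  have [[k nBk]|allB] := pselect (exists k, ~ B k w); last first.
    have {}allB k : B k w by apply: contrapT => nBk; apply: allB; exists k.
    (* At a point of every [B k] each term is at least [C], so the series diverges. *)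
    suff -> : \sum_(0 <= k <oo) (C * rho ^+ k)%:E * (\1_(B k) w)%:E = +oo.
      by rewrite leey.
    apply/eqyP => A A0.
    apply: le_trans (partial (Num.truncn (A / C)).+1).
    apply: (@le_trans _ _ (\sum_(0 <= k < (Num.truncn (A / C)).+1) C%:E)).
      rewrite sumEFin sumr_const_nat subn0 lee_fin -[leRHS]mulr_natr mulrC.
      by rewrite -ler_pdivrMr// ltW// truncnS_gt.
    apply: lee_sum => k _; rewrite indicE mem_set// mule1 lee_fin.
    by rewrite ler_peMr ?exprn_ege1// ltW.
  have [l Bl nBl] : exists2 l, B l w & ~ B l.+1 w.
    elim: k nBk => [|k IH] nBk; first by exfalso; apply: nBk; rewrite B0.
    by have [Bk|/IH//] := pselect (B k w); exists k.
  apply: le_trans (FB _ _ nBl) _; apply: le_trans (partial l.+1).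
  rewrite big_nat_recr//= indicE mem_set// mule1 leeDr//.
  by apply: sume_ge0 => j _.
rewrite integral_nneseries//; last by move=> k; exact: mindic.
apply: (@le_lt_trans _ _ (\sum_(0 <= k <oo) (C * D * (rho * q) ^+ k)%:E)).
  apply: lee_nneseries => k *; first exact: integral_ge0.
  have a0 : (0 <= C * rho ^+ k)%R by rewrite mulr_ge0 ?exprn_ge0// ltW.
  rewrite int_indic//; apply: (@le_trans _ _ ((C * rho ^+ k)%:E * (D * q ^+ k)%:E)).
    by apply: lee_wpmul2l => //; rewrite lee_fin.
  by rewrite -EFinM lee_fin exprMn mulrACA.
apply: (@le_lt_trans _ _ (C * D / (1 - rho * q))%:E); last exact: ltry.
have rq0 : (0 < rho * q)%R by rewrite mulr_gt0.
apply: lime_le.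
  apply: is_cvg_nneseries => k _ _; rewrite lee_fin mulr_ge0 ?exprn_ge0 ?(ltW rq0)//.
  by rewrite mulr_ge0// ltW.
apply: nearW => n; rewrite sumEFin lee_fin.
apply: (geometric_le_lim n) => //; first by rewrite mulr_ge0// ltW.
by rewrite gtr0_norm.
Qed.

(** [F] dominates the sum of [a * rho ^+ k] over the [k] with [w] in [B k], as a geometric sum is
    controlled by its last term. Each summand integrates to at least [a * b], so the integral
    exceeds every multiple of it. *)
Lemma integral_eq_pinfty_tail (B : nat -> set T) (b c rho : R) :
  (0 < b)%R -> (0 < c)%R -> (1 < rho)%R ->
  (forall k, measurable (B k)) ->
  (forall k, (b / rho ^+ k)%:E <= P (B k)) ->
  (forall k w, B k w -> (c * rho ^+ k)%:E <= F w) ->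
  \int[P]_w F w = +oo.
Proof.
move=> b0 c0 rho1 mB PB FB.
have rho0 : (0 < rho)%R by exact: lt_trans rho1.
have rhoX k : (0 < rho ^+ k)%R by rewrite exprn_gt0.
(* With this constant the sum of [a * rho ^+ k] over [k <= n] is at most [c * rho ^+ n]. *)
pose a : R := (c * (rho - 1) / rho)%R.
have a0 : (0 < a)%R by rewrite divr_gt0 ?mulr_gt0 ?subr_gt0.
have geo (n : nat) w : (\sum_(k < n) (rho - 1) * rho ^+ k * \1_(B k) w <= rho ^+ n - 1 :> R)%R.
  elim: n => [|n IH]; first by rewrite big_ord0 expr0 subrr.
  rewrite big_ord_recr/=; apply: (le_trans (lerD IH (_ : _ <= (rho - 1) * rho ^+ n)%R)).
    by rewrite ler_piMr ?indic_le1// mulr_ge0// ?subr_ge0 ltW.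
  by rewrite exprS le_eqVlt; apply/orP; left; apply/eqP; ring.
have low n w : (\sum_(k < n) a * rho ^+ k * \1_(B k) w)%:E <= F w.
  elim: n => [|n IH]; first by rewrite big_ord0.
  have [Bw|nBw] := pselect (B n w); last first.
    by rewrite big_ord_recr/= indicE memNset// mulr0 addr0.
  apply: (le_trans _ (FB n w Bw)); rewrite lee_fin.
  have -> : (\sum_(k < n.+1) a * rho ^+ k * \1_(B k) w =
      c / rho * \sum_(k < n.+1) (rho - 1) * rho ^+ k * \1_(B k) w)%R.
    by rewrite mulr_sumr; apply: eq_bigr => k _; rewrite /a; field; rewrite gt_eqF.
  rewrite mulrAC ler_pdivrMr// -!mulrA -exprSr ler_pM2l//.
  by rewrite (le_trans (geo n.+1 w))// gerBl.
clearbody a.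
have ab0 : (0 < a * b)%R by rewrite mulr_gt0.
have int_ge n : (n%:R * (a * b))%:E <= \int[P]_w F w.
  apply: (@le_trans _ _ (\int[P]_w \sum_(k < n) (a * rho ^+ k)%:E * (\1_(B k) w)%:E)); last first.
    apply: le_integral_nonmeasurable => w.
      apply: sume_ge0 => k _; rewrite -EFinM lee_fin.
      by rewrite !mulr_ge0 ?(ltW a0) ?(ltW (rhoX k)).
    apply: (le_trans _ (low n w)); rewrite -sumEFin.
    by apply: lee_sum => k _; rewrite -EFinM.
  have mterm k : measurable_fun [set: T] ((fun w => (a * rho ^+ k)%:E * (\1_(B k) w)%:E) : T -> \bar R).
    exact: mindic.
  have -> : \int[P]_w \sum_(k < n) (a * rho ^+ k)%:E * (\1_(B k) w)%:E =
      \sum_(k < n) \int[P]_w ((a * rho ^+ k)%:E * (\1_(B k) w)%:E).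
    rewrite ge0_integral_sum// => k w _.
    by rewrite -EFinM lee_fin !mulr_ge0 ?(ltW a0) ?(ltW (rhoX k))//.
  have -> : (n%:R * (a * b))%:E = \sum_(k < n) (a * b)%:E.
    by rewrite sumEFin sumr_const card_ord mulr_natl.
  apply: lee_sum => k _; rewrite int_indic//; last by rewrite mulr_ge0 ?(ltW a0) ?(ltW (rhoX k)).
  apply: (le_trans _ (lee_wpmul2l _ (PB k))); last by rewrite lee_fin mulr_ge0 ?(ltW a0) ?(ltW (rhoX k)).
  by rewrite -EFinM lee_fin le_eqVlt; apply/orP; left; apply/eqP; field; rewrite gt_eqF.
apply/eqyP => A A0.
apply: (le_trans _ (int_ge (Num.truncn (A / (a * b))).+1)).
by rewrite lee_fin -ler_pdivrMr// ltW// truncnS_gt.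
Qed.

End TailIntegral.

(** * Growth of the scale function *)

Section PowerSums.
Context {R : realType}.
Implicit Types (k th x y : R).

Lemma powR_bernoulli k y : 0 <= k <= 1 -> -1 <= y -> (1 + y) `^ k <= 1 + k * y.
Proof.
move=> /andP[k0 k1]; rewrite le_eqVlt => /predU1P[<-|y1].
  rewrite subrr mulrN1; have [->|kn0] := eqVneq k 0; first by rewrite powRr0 subr0.
  by rewrite powR0// subr_ge0.
have z0 : 0 < 1 + y by rewrite -ltrBlDl sub0r.
set z := 1 + y in z0 *; have -> : y = z - 1 by rewrite /z addrC addKr.
(* The tangent of [expR] at [k * L] lies below [expR] at [L] and at [0]. *)
rewrite -[z in X in X <= _](lnK z0) -expRM; set L := ln z.
have zL : z = expR L by rewrite /L lnK.
have W0 := expR_gt0 (k * L).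
have h1 : expR (k * L) * (1 + (1 - k) * L) <= z.
  rewrite zL [leRHS](_ : _ = expR (k * L) * expR ((1 - k) * L)); last first.
    by rewrite -expRD; congr expR; ring.
  by rewrite ler_pM2l// expR_ge1Dx.
have h2 : expR (k * L) * (1 - k * L) <= 1.
  by rewrite -[leRHS](expRxMexpNx_1 (k * L)) ler_pM2l// expR_ge1Dx.
(* Weighting the two tangent bounds by [k] and [1 - k] cancels [L]. *)
have h1' := ler_wpM2l k0 h1.
have k1' : 0 <= 1 - k by rewrite subr_ge0.
have h2' := ler_wpM2l k1' h2.
rewrite mulrC.
by move: h1' h2'; set W := expR _; lra.
Qed.

(** Bernoulli at [y = - 1 / (n + 1)] bounds each term by the increment of [n ^ th]. *)
Lemma sum_powR_le th n : 0 < th <= 1 ->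
  th * \sum_(j < n) j.+1%:R `^ (th - 1) <= n%:R `^ th.
Proof.
move=> /andP[th0 th1]; elim: n => [|n IH]; first by rewrite big_ord0 mulr0 powR_ge0.
rewrite big_ord_recr/= mulrDr -lerBrDl.
apply: (@le_trans _ _ (n.+1%:R `^ th - n%:R `^ th)); last by rewrite lerD2l lerN2.
rewrite lerBrDl -lerBrDr.
have n1 : 0 < n.+1%:R :> R by [].
have nE : n%:R = n.+1%:R * (1 + - n.+1%:R^-1) :> R.
  by rewrite mulrDr mulrN divff// mulr1 -natr1 addrK.
have inv1 : n.+1%:R^-1 <= 1 :> R by rewrite invf_le1// ler1n.
rewrite [in leLHS]nE powRM//; last by rewrite subr_ge0.
apply: (@le_trans _ _ (n.+1%:R `^ th * (1 + th * - n.+1%:R^-1))).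
  by rewrite ler_pM2l ?powR_gt0// powR_bernoulli ?lerN2// (ltW th0).
rewrite mulrDr mulr1 lerD2l mulrN mulrN lerN2 powRB; last by rewrite pnatr_eq0 implybT.
by rewrite powRr1 ?(ltW n1)// mulrCA lexx.
Qed.

Lemma exprn_powR x th n : 0 <= x -> (x ^+ n) `^ th = (x `^ th) ^+ n.
Proof. by move=> x0; rewrite -!powR_mulrn ?powR_ge0// powRAC. Qed.

Lemma harmonic_ge_ln n : ln n.+1%:R <= \sum_(j < n) j.+1%:R^-1 :> R.
Proof.
elim: n => [|n IH]; first by rewrite ln1 big_ord0.
rewrite big_ord_recr/=.
have -> : n.+2%:R = n.+1%:R * (1 + n.+1%:R^-1) :> R.
  by rewrite mulrDr divff// mulr1 -natr1.
have i0 : 0 < n.+1%:R^-1 :> R by rewrite invr_gt0.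
by rewrite lnM ?posrE ?addr_gt0// lerD// le_ln1Dx// (lt_trans _ i0)// ltrN10.
Qed.

Lemma harmonic_le_ln n : \sum_(j < n.+1) j.+1%:R^-1 <= 1 + ln n.+1%:R :> R.
Proof.
elim: n => [|n IH]; first by rewrite big_ord1 ln1 addr0 invr1.
rewrite big_ord_recr/= (le_trans (lerD IH (lexx _)))// -addrA lerD2l.
have nE : n.+1%:R = n.+2%:R * (1 + - n.+2%:R^-1) :> R.
  by rewrite mulrDr mulrN divff// mulr1 -[n.+2%:R]natr1 addrK.
have i1 : n.+2%:R^-1 < 1 :> R by rewrite invf_lt1// ltr1n.
rewrite nE lnM ?posrE//; last by rewrite subr_gt0.
have := @le_ln1Dx R (- n.+2%:R^-1); rewrite ltrN2 => /(_ i1) h.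
by rewrite -addrA gerDl -lerBrDr sub0r.
Qed.

End PowerSums.

(** * Scale and speed of the linear growth model *)

Section LinearGrowthScale.
Context {R : realType} (m r s : R).
Hypotheses (m0 : 0 < m) (r0 : 0 <= r) (s0 : 0 < s).
Local Notation alpha := (fun n : nat => m * n%:R + r).
Local Notation beta := (fun n : nat => m * n%:R + s).

Section Critical.
Hypothesis sr : s - r = m.

(** When [s - r = m] the rates satisfy [alpha j.+1 = beta j], so the product does not change with
    [j]. *)
Lemma beta_scale_step_critical j : beta j * scale_step alpha beta j = 1.
Proof.
have bet0 := beta_gt0 m s m0 s0.
elim: j => [|j IH].
  by rewrite /scale_step big_ord0 mul1r divff// gt_eqF// bet0.
rewrite (scale_stepS alpha beta bet0) -[RHS]IH; congr (_ * _).
by rewrite -natr1 -sr; ring.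
Qed.

Lemma speed_critical k : speed alpha beta k = 1.
Proof. by rewrite /speed beta_scale_step_critical invr1. Qed.

Lemma scale_step_critical j : scale_step alpha beta j = (m * j%:R + s)^-1.
Proof.
have b0 : m * j%:R + s != 0 by rewrite gt_eqF// (beta_gt0 m s m0 s0 j).
by apply: (mulfI b0); rewrite divff// beta_scale_step_critical.
Qed.

(** This crude bound suffices for choosing time scales, which enter the moment only through their
    logarithm. *)
Lemma scale_critical_le_lin n : scale alpha beta n <= n%:R / s.
Proof.
rewrite mulrC mulr_natr -[n in X in _ <= X]card_ord -sumr_const; apply: ler_sum => j _.
rewrite scale_step_critical lef_pV2 ?posrE ?lerDr ?mulr_ge0 ?(ltW m0)//.
exact: (beta_gt0 m s m0 s0 j).
Qed.

Lemma scale_critical_ge_ln n : ln n.+1%:R / (m + s) <= scale alpha beta n.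
Proof.
rewrite ler_pdivrMr ?addr_gt0// (le_trans (harmonic_ge_ln n))// mulr_suml.
apply: ler_sum => j _; rewrite scale_step_critical.
have bj := beta_gt0 m s m0 s0 j.
rewrite ler_pdivlMl// ler_pdivrMr//.
by rewrite -natr1; have : 0 <= j%:R :> R by []; have := m0; have := s0; nra.
Qed.

Lemma scale_critical_le_ln n :
  scale alpha beta n.+1 <= (m^-1 + s^-1) * (1 + ln n.+1%:R).
Proof.
have ms0 : 0 < m^-1 + s^-1 by rewrite addr_gt0 ?invr_gt0.
apply: (@le_trans _ _ ((m^-1 + s^-1) * \sum_(j < n.+1) j.+1%:R^-1)); last first.
  by rewrite ler_pM2l// harmonic_le_ln.
rewrite mulr_sumr; apply: ler_sum => j _; rewrite scale_step_critical.
have bj := beta_gt0 m s m0 s0 j.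
rewrite ler_pdivlMr// ler_pdivrMl// -natr1.
have -> : (m * j%:R + s) * (m^-1 + s^-1) = j%:R + 1 + (m * j%:R / s + s / m).
  by field; rewrite !gt_eqF.
by rewrite lerDl addr_ge0// divr_ge0 ?mulr_ge0// ltW.
Qed.

End Critical.

Section Subcritical.
Hypothesis sr : 0 <= s - r < m.
Let kappa := (s - r) / m.

Let kappa01 : 0 <= kappa < 1.
Proof.
by case/andP: sr => sr0 srm; rewrite divr_ge0 ?(ltW m0)//= ltr_pdivrMr// mul1r.
Qed.

Let alpha_div_beta j : alpha j.+1 / beta j.+1 = 1 - kappa / (j.+1%:R + s / m).
Proof.
have b0 : m * j.+1%:R + s != 0 by rewrite gt_eqF// (beta_gt0 m s m0 s0 j.+1).
have E : (1 + j%:R) * m + s = m * j.+1%:R + s by rewrite -natr1; ring.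
by rewrite /kappa; field; rewrite E b0 gt_eqF.
Qed.

Let bet0 := beta_gt0 m s m0 s0.
Let sm0 : 0 < s / m. Proof. by rewrite divr_gt0. Qed.

Let scale_step_ratio j : scale_step alpha beta j.+1 =
  (1 - kappa / (j.+1%:R + s / m)) * scale_step alpha beta j.
Proof.
rewrite -alpha_div_beta mulrAC -(scale_stepS alpha beta bet0) mulrAC divff ?mul1r//.
by rewrite gt_eqF// (bet0 j.+1).
Qed.

Let scale_step_ge0 j : 0 <= scale_step alpha beta j.
Proof. exact/ltW/scale_step_gt0/(beta_gt0 m s m0 s0)/(alpha_gt0 m r m0 r0). Qed.

(** With [b j = j + 1 + s / m], the product [scale_step j * b j ^ kappa] is nonincreasing: by
    Bernoulli its ratio is at most [(1 - kappa / b j) * (1 + kappa / b j)]. *)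
Lemma scale_step_powR_le : exists2 C : R, 0 < C &
  forall j, scale_step alpha beta j <= C * j.+1%:R `^ (- kappa).
Proof.
have [k0 k1] := andP kappa01.
pose b j : R := j.+1%:R + s / m.
have b_gt0 j : 0 < b j by rewrite addr_gt0.
have step j : scale_step alpha beta j * (b j) `^ kappa <= s^-1 * (b 0%N) `^ kappa.
  elim: j => [|j IH].
    by rewrite /scale_step big_ord0 mul1r mulr0 add0r.
  rewrite scale_step_ratio -/(b j); apply: le_trans IH.
  rewrite mulrAC [leLHS]mulrC; apply: ler_wpM2l => //.
  have -> : b j.+1 = b j * (1 + (b j)^-1).
    by rewrite mulrDr divff ?gt_eqF// mulr1 /b -[j.+2%:R]natr1; ring.
  have bj0 : 0 <= (b j)^-1 by rewrite invr_ge0 ltW.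
  have bj1 : (b j)^-1 <= 1.
    by rewrite invf_le1// (le_trans (_ : 1 <= j.+1%:R))// ?ler1n// lerDl ltW.
  rewrite powRM ?(ltW (b_gt0 j)) ?addr_ge0// mulrCA ler_piMr ?powR_ge0//.
  have kb1 : kappa / b j <= 1 by rewrite mulr_ile1// ltW.
  have bern := powR_bernoulli kappa (b j)^-1.
  have {}bern : (1 + (b j)^-1) `^ kappa <= 1 + kappa / b j.
    by apply: bern; rewrite ?k0 ?(ltW k1)// (le_trans _ bj0).
  apply: (le_trans (ler_wpM2l _ bern)); first by rewrite subr_ge0.
  by have := sqr_ge0 (kappa / b j); nra.
exists (s^-1 * (b 0%N) `^ kappa); first by rewrite mulr_gt0 ?invr_gt0 ?powR_gt0.
move=> j; rewrite powRN ler_pdivlMr ?powR_gt0//.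
apply: le_trans (step j); apply: ler_wpM2l => //.
by rewrite ge0_ler_powR ?nnegrE ?(ltW (b_gt0 j))// lerDl ltW.
Qed.

(** With [b] shifted by one, the same product is nondecreasing, by Bernoulli at [- 1 / b j.+1]. *)
Lemma scale_step_powR_ge : exists2 C : R, 0 < C &
  forall j, C * j.+1%:R `^ (- kappa) <= scale_step alpha beta j.
Proof.
have [k0 k1] := andP kappa01.
pose b j : R := j%:R + s / m.
have b_gt0 j : 0 < b j by rewrite ltr_wpDl.
have step j : s^-1 * (b 0%N) `^ kappa <= scale_step alpha beta j * (b j) `^ kappa.
  elim: j => [|j IH].
    by rewrite /scale_step big_ord0 mul1r mulr0 add0r.
  rewrite scale_step_ratio -/(b j.+1); apply: (le_trans IH).
  rewrite [leRHS]mulrAC [leRHS]mulrC; apply: ler_wpM2l => //.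
  have -> : b j = b j.+1 * (1 + - (b j.+1)^-1).
    by rewrite mulrDr mulrN divff ?gt_eqF// mulr1 /b -[j.+1%:R]natr1; ring.
  have bj1 : (b j.+1)^-1 <= 1.
    by rewrite invf_le1// (le_trans (_ : 1 <= j.+1%:R))// ?ler1n// lerDl ltW.
  rewrite powRM ?subr_ge0 ?(ltW (b_gt0 j.+1))// [leRHS]mulrC ler_wpM2l ?powR_ge0//.
  have := powR_bernoulli kappa (- (b j.+1)^-1).
  by rewrite mulrN; apply; rewrite ?lerN2// k0 ltW.
have d0 : 0 < 1 + s / m by rewrite addr_gt0.
exists (s^-1 * (b 0%N) `^ kappa / (1 + s / m) `^ kappa).
  by rewrite divr_gt0 ?mulr_gt0 ?invr_gt0 ?powR_gt0.
move=> j; rewrite powRN ler_pdivrMr ?powR_gt0// ler_pdivrMr ?powR_gt0//.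
apply: (le_trans (step j)); rewrite -mulrA; apply: ler_wpM2l => //.
rewrite -powRM ?(ltW d0)// ge0_ler_powR ?nnegrE ?k0 ?mulr_ge0 ?(ltW (b_gt0 j)) ?(ltW d0)//.
have j0 : 0 <= j%:R :> R by [].
by have := sm0; rewrite /b -natr1; nra.
Qed.

Lemma scale_powR_le : exists2 C : R, 0 < C &
  forall n, scale alpha beta n <= C * n%:R `^ (1 - kappa).
Proof.
have [k0 k1] := andP kappa01.
have [C C0 HC] := scale_step_powR_le.
have t0 : 0 < 1 - kappa by rewrite subr_gt0.
exists (C / (1 - kappa)) => [|n]; first by rewrite divr_gt0.
apply: (@le_trans _ _ (\sum_(j < n) C * j.+1%:R `^ (- kappa))).
  by apply: ler_sum => j _.
rewrite -mulr_sumr -mulrA; apply: ler_wpM2l; first exact: ltW.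
have := sum_powR_le (1 - kappa) n; rewrite t0 gerBl k0 addrAC subrr sub0r.
by rewrite ler_pdivlMl//; apply.
Qed.

(** The lower bounds on the steps decrease with [j], so each of the [n] terms is at least the last
    one. *)
Lemma scale_powR_ge : exists2 C : R, 0 < C &
  forall n, C * n%:R `^ (1 - kappa) <= scale alpha beta n.
Proof.
have [k0 k1] := andP kappa01.
have [C C0 HC] := scale_step_powR_ge.
exists C => // -[|n].
  by rewrite /scale big_ord0 powR0 ?mulr0// gt_eqF// subr_gt0.
apply: (@le_trans _ _ (\sum_(j < n.+1) C * n.+1%:R `^ (- kappa))).
  rewrite sumr_const card_ord -mulrnAr; apply: ler_wpM2l; first exact: ltW.
  by rewrite powRD ?pnatr_eq0 ?implybT// powRr1// mulr_natl.
apply: ler_sum => j _; apply: le_trans (HC j); apply: ler_wpM2l; first exact: ltW.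
by rewrite !powRN lef_pV2 ?posrE ?powR_gt0// ge0_ler_powR ?nnegrE// ler_nat.
Qed.

(** The speed is of order at most [k ^ (kappa - 1)]. The margin [e] keeps the exponent positive when
    [kappa = 0], where the sum of these bounds is logarithmic. *)
Lemma sum_speed_powR_le (e : R) : 0 < e <= 1 - kappa -> exists2 C : R, 0 < C &
  forall n, \sum_(k < n) speed alpha beta k <= C * n%:R `^ (kappa + e).
Proof.
move=> /andP[e0 ek]; have [k0 k1] := andP kappa01.
have [C C0 HC] := scale_step_powR_ge.
have ke : 0 < kappa + e <= 1 by rewrite ltr_wpDl//= -lerBrDl.
pose D := (m^-1 + s^-1) / C.
have ms0 : 0 < m^-1 + s^-1 by rewrite addr_gt0 ?invr_gt0.
have D0 : 0 < D by rewrite divr_gt0.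
exists (D / (kappa + e)) => [|n]; first by rewrite divr_gt0//; case/andP: ke.
apply: (@le_trans _ _ (\sum_(k < n) D * k.+1%:R `^ (kappa + e - 1))); last first.
  rewrite -mulr_sumr -(mulrA D); apply: ler_wpM2l; first exact: ltW.
  by rewrite ler_pdivlMl ?sum_powR_le//; case/andP: ke.
apply: ler_sum => k _; rewrite /speed.
have K0 : 0 < k.+1%:R :> R by [].
apply: (@le_trans _ _ (D * k.+1%:R `^ (kappa - 1))); last first.
  by rewrite ler_pM2l// ler_powR ?ler1n// lerD2r lerDl ltW.
have bk := bet0 k.
have step0 : 0 < C * k.+1%:R `^ (- kappa) by rewrite mulr_gt0 ?powR_gt0.
have b1 : k.+1%:R / (m^-1 + s^-1) <= m * k%:R + s.
  rewrite ler_pdivrMr// -natr1.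
  have -> : (m * k%:R + s) * (m^-1 + s^-1) = k%:R + 1 + (m * k%:R / s + s / m).
    by field; rewrite !gt_eqF.
  by rewrite lerDl addr_ge0// divr_ge0 ?mulr_ge0// ltW.
apply: (@le_trans _ _ (k.+1%:R / (m^-1 + s^-1) * (C * k.+1%:R `^ (- kappa)))^-1).
  have sk := scale_step_gt0 alpha beta (alpha_gt0 m r m0 r0) bet0 k.
  have kms : 0 < k.+1%:R / (m^-1 + s^-1) by rewrite divr_gt0.
  rewrite lef_pV2 ?posrE; [|exact: mulr_gt0|exact: mulr_gt0].
  by rewrite ler_pM ?divr_ge0 ?(ltW step0) ?(ltW ms0).
rewrite powRN (powRB (_ : _ ==> _)) ?pnatr_eq0 ?implybT// powRr1 ?(ltW K0)//.
rewrite le_eqVlt; apply/orP; left; apply/eqP; rewrite /D; field.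
by rewrite !gt_eqF// ?powR_gt0// addr_gt0.
Qed.

End Subcritical.
End LinearGrowthScale.

(** * Moments of the return time *)

Lemma log_weight_ge0 {R : realType} (g : R) (x : \bar R) : (0 <= log_weight g x)%E.
Proof. by rewrite /log_weight; case: ifP => _; [exact: lee01|exact: poweR_ge0]. Qed.

Lemma log_weight_le {R : realType} (g L : R) (x : \bar R) :
  0 <= g -> 1 <= L -> (x <= (expR L)%:E)%E -> (log_weight g x <= (L `^ g)%:E)%E.
Proof.
move=> g0 L1 xL; rewrite /log_weight; case: ifPn => [_|].
  have <- : 1 `^ g = 1 :> R by rewrite powR1.
  by rewrite lee_fin ge0_ler_powR ?nnegrE// (le_trans ler01).
rewrite -ltNge; case: x xL => [x| |]//; rewrite lee_fin lte_fin => xL ex.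
have x0 : 0 < x by exact: lt_trans ex; exact: expR_gt0.
have lx0 : 0 <= ln x by rewrite ln_ge0// (le_trans _ (ltW ex))// -expR0 ler_expR.
rewrite lne_EFin// poweR_EFin lee_fin ge0_ler_powR ?nnegrE ?(le_trans ler01 L1)//.
by rewrite -[leRHS]expRK ler_ln ?posrE ?expR_gt0.
Qed.

(** If [x] is at most [e] then [L <= 1] and the weight [1] suffices; at [+oo] the weight is infinite
    since [g] is positive. *)
Lemma log_weight_ge {R : realType} (g L : R) (x : \bar R) :
  0 < g -> 0 <= L -> ((expR L)%:E <= x)%E -> ((L `^ g)%:E <= log_weight g x)%E.
Proof.
move=> g0 L0 Lx; rewrite /log_weight; case: ifPn => [xe|].
  have L1 : L <= 1 by rewrite -ler_expR -lee_fin (le_trans Lx).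
  have <- : 1 `^ g = 1 :> R by rewrite powR1.
  by rewrite lee_fin ge0_ler_powR ?nnegrE// ltW.
rewrite -ltNge; case: x Lx => [x| |]//; last first.
  by move=> _ _; rewrite /= gt_eqF// leey.
rewrite lee_fin lte_fin => Lx ex.
have x0 : 0 < x by exact: lt_trans ex; exact: expR_gt0.
have Lln : L <= ln x by rewrite -[leLHS]expRK ler_ln ?posrE ?expR_gt0.
by rewrite lne_EFin// poweR_EFin lee_fin ge0_ler_powR ?nnegrE ?(ltW g0) ?(le_trans L0 Lln).
Qed.

Section Moments.
Context {R : realType} {d : measure_display} {T : measurableType d}
  {P : probability T R} (X : R -> {RV P >-> nat}) (m r s : R).
Hypotheses (m0 : 0 < m) (r0 : 0 <= r) (s0 : 0 < s) (rs : r <= s).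
Hypothesis hX : is_Markov_chain X (linear_growth_Q m r m s) 0%N.
Local Notation alpha := (fun n : nat => m * n%:R + r).
Local Notation beta := (fun n : nat => m * n%:R + s).

Let return_time0_ge0 w : (0 <= return_time0 X w)%E.
Proof.
apply: le_ereal_inf_tmp => _ [t [ft _] <-]; apply: le_trans (ltW ft).
by apply: le_ereal_inf_tmp => _ [u [u0 _] <-]; rewrite lee_fin.
Qed.

(** The tail at [t k] is at most [4 / s * D * q ^+ k], while [F] is at most [C * rho ^+ k] up to
    [t k]; the layers are summable as [rho * q < 1]. *)
Lemma integral_return_time_lt_pinfty (F : T -> \bar R) (t : nat -> R)
    (N : nat -> nat) (C D rho q : R) :
  (forall w, 0 <= F w)%E -> 0 < C -> 0 < D -> 1 <= rho -> 0 < q -> rho * q < 1 ->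
  (forall k, 0 < t k) -> (forall k, (0 < N k)%N) ->
  (forall k, 2 * scale alpha beta (N k) * (\sum_(i < N k) speed alpha beta i) <= t k) ->
  (forall k, (scale alpha beta (N k))^-1 <= D * q ^+ k) ->
  (forall k, (t k)^-1 <= D * q ^+ k) ->
  (forall k w, (return_time0 X w <= (t k)%:E)%E -> (F w <= (C * rho ^+ k)%:E)%E) ->
  (\int[P]_w F w < +oo)%E.
Proof.
move=> F0 C0 D0 rho1 q0 rq t0 N0 Nt ND tD Ft.
have a0 := alpha_gt0 m r m0 r0.
have b0 := beta_gt0 m s m0 s0.
have [B HB] := choice (fun k => return_time_tail_le_scale alpha beta a0 b0 X hX
  (t k) (N k) (t0 k) (N0 k) (Nt k)).
(* The tail sets are shifted by one to start from the whole space; the shift costs the factor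
   [1 / q]. *)
pose A k := if k is k.+1 then B k else [set: T].
have D40 : 0 < 4 / s * D / q by rewrite !divr_gt0 ?mulr_gt0 ?invr_gt0.
apply: (integral_lt_pinfty_tail P F F0 A C (1 + 4 / s * D / q) rho q) => //.
- by case=> [|k] /=; [exact: measurableT | case: (HB k)].
- case=> [|k] /=.
    by rewrite probability_setT expr0 mulr1 lee_fin lerDl ltW.
  have [_ _] := HB k; move/le_trans; apply; rewrite lee_fin mulr0 add0r.
  have -> : (1 + 4 / s * D / q) * q ^+ k.+1 = q * q ^+ k +
      (2 / s * (D * q ^+ k) + 2 / s * (D * q ^+ k)).
    by rewrite exprS; field; rewrite !gt_eqF.
  rewrite !invfM !mulrA.
  have := ler_wpM2l (ltW (_ : 0 < 2 / s)) (ND k).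
  have := ler_wpM2l (ltW (_ : 0 < 2 / s)) (tD k).
  have s2 : 0 < 2 / s by rewrite divr_gt0.
  have qk : 0 <= q * q ^+ k by rewrite mulr_ge0 ?exprn_ge0 ?ltW.
  by move=> /(_ s2) h1 /(_ s2) h2; rewrite -(mulrA (2 / s) D) ler_wpDl// lerD.
- move=> k w nBw; apply: Ft; rewrite leNgt; apply/negP => tw.
  by apply: nBw; have [_ + _] := HB k; apply.
Qed.

(** The tail at level [M k] is at least a multiple of [1 / rho ^+ k], and [F] at least a multiple of
    [rho ^+ k] there: every scale contributes a fixed amount. *)
Lemma integral_return_time_eq_pinfty (F : T -> \bar R) (M : nat -> nat) (C D rho : R) :
  (forall w, 0 <= F w)%E -> 0 < C -> 0 < D -> 1 < rho ->
  (forall k, (0 < M k)%N) ->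
  (forall k, scale alpha beta (M k) <= D * rho ^+ k) ->
  (forall k w, (((M k)%:R / (4 * growth_constant m r s))%:E <= return_time0 X w)%E ->
    ((C * rho ^+ k)%:E <= F w)%E) ->
  (\int[P]_w F w = +oo)%E.
Proof.
move=> F0 C0 D0 rho1 M0 MD FM.
have [B HB] := choice (fun k => return_time_tail_ge_scale X m r s m0 r0 s0 rs hX
  (M k) (M0 k)).
apply: (integral_eq_pinfty_tail P F F0 B (4 * s * D)^-1 C rho) => //.
- by rewrite invr_gt0 !mulr_gt0.
- by move=> k; case: (HB k).
- move=> k; have [_ _] := HB k; apply: le_trans; rewrite lee_fin -invfM.
  have rk : 0 < rho ^+ k by rewrite exprn_gt0// (lt_trans ltr01).
  have sM := scale_gt0 alpha beta (alpha_gt0 m r m0 r0) (beta_gt0 m s m0 s0) (M k) (M0 k).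
  rewrite lef_pV2 ?posrE ?mulr_gt0//.
  by rewrite -[leRHS]mulrA ler_wpM2l ?mulr_ge0 ?(ltW s0).
- by move=> k w Bw; apply: FM; have [_ + _] := HB k; apply.
Qed.

Lemma powR_moment_lt_pinfty (a : R) : 0 <= s - r < m ->
  0 < a < 1 - (s - r) / m -> (\int[P]_w (return_time0 X w `^ a) < +oo)%E.
Proof.
move=> sr /andP[a0 ath]; set kappa := (s - r) / m in ath.
have k0 : 0 <= kappa by case/andP: sr => ? _; rewrite divr_ge0// ltW.
pose e := 1 - kappa - a.
have e0 : 0 < e by rewrite subr_gt0.
have eth : 0 < e <= 1 - kappa by rewrite e0/= gerBl ltW.
have [C1 C10 HC1] := scale_powR_le m r s m0 r0 s0 sr.
have [C2 C20 HC2] := scale_powR_ge m r s m0 r0 s0 sr.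
have [C3 C30 HC3] := sum_speed_powR_le m r s m0 r0 s0 sr e eth.
rewrite -/kappa in HC1 HC2 HC3.
(* At level [2 ^ k] the scale has exponent [th] and the total speed [kappa + e], so the time scale
   has exponent [1 + e]. *)
pose b := 2 `^ (1 + e); pose th := 1 - kappa.
have b0 : 0 < b by rewrite powR_gt0.
have q1 : 1 <= 2 `^ th :> R.
  by rewrite -[leLHS](powRr0 2) ler_powR ?ler1n// /th; lra.
have q0 : 0 < 2 `^ th :> R by rewrite powR_gt0.
have C0 : 0 < 2 * C1 * C3 by rewrite !mulr_gt0.
have n2 k x : (2 ^ k)%:R `^ x = (2 `^ x) ^+ k :> R by rewrite natrX exprn_powR.
have qV k : (2 `^ (- th)) ^+ k = ((2 `^ th) ^+ k)^-1 :> R by rewrite powRN exprVn.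
apply: (integral_return_time_lt_pinfty _ (fun k => 2 * C1 * C3 * b ^+ k)
  (fun k => (2 ^ k)%N) ((2 * C1 * C3) `^ a) (C2^-1 + (2 * C1 * C3)^-1) (b `^ a) (2 `^ (- th))).
- by move=> w; exact: poweR_ge0.
- exact: powR_gt0.
- by rewrite addr_gt0 ?invr_gt0.
- rewrite -(powRr0 b) ler_powR ?(ltW a0)//.
  by rewrite -[leLHS](powRr0 2) ler_powR ?ler1n// ler_wpDr ?ltW.
- exact: powR_gt0.
- rewrite -powRrM -powRD ?pnatr_eq0 ?implybT//.
  rewrite /powR pnatr_eq0/= expR_lt1 pmulr_llt0 ?ln_gt0 ?ltr1n//.
  have a1 : a < 1 by rewrite (lt_le_trans ath)// gerBl.
  (* The exponent [(1 + e) * a - th] equals [- (th - a) * (1 - a)] because [e = th - a]. *)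
  have := mulr_gt0 (_ : 0 < th - a) (_ : 0 < 1 - a).
  rewrite !subr_gt0 => /(_ ath a1).
  rewrite (_ : e = th - a)//; nra.
- by move=> k; rewrite mulr_gt0 ?exprn_gt0.
- by move=> k; rewrite expn_gt0.
- move=> k; have := HC1 (2 ^ k)%N; have := HC3 (2 ^ k)%N; rewrite !n2 => h3 h1.
  have -> : 2 * C1 * C3 * b ^+ k = 2 * (C1 * (2 `^ th) ^+ k) * (C3 * (2 `^ (kappa + e)) ^+ k).
    rewrite /b (_ : 1 + e = th + (kappa + e)); last by rewrite /th; ring.
    by rewrite powRD ?pnatr_eq0 ?implybT// exprMn; ring.
  apply: ler_pM => //.
  + by rewrite mulr_ge0// scale_ge0//; [exact: alpha_gt0|exact: beta_gt0].
  + apply: sumr_ge0 => i _; apply/ltW/speed_gt0; [exact: alpha_gt0|exact: beta_gt0].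
  + by rewrite ler_pM2l.
- move=> k; have := HC2 (2 ^ k)%N; rewrite n2 qV => h2.
  have qk : 0 < (2 `^ th) ^+ k :> R by rewrite exprn_gt0.
  apply: (@le_trans _ _ (C2^-1 * ((2 `^ th) ^+ k)^-1)).
    rewrite -invfM lef_pV2 ?posrE ?mulr_gt0//.
    by apply: scale_gt0; [exact: alpha_gt0|exact: beta_gt0|rewrite expn_gt0].
  by rewrite ler_pM2r ?invr_gt0// lerDl invr_ge0 ltW.
- move=> k; rewrite qV.
  have qk : 0 < (2 `^ th) ^+ k :> R by rewrite exprn_gt0.
  have bk : 0 < b ^+ k by rewrite exprn_gt0.
  apply: (@le_trans _ _ ((2 * C1 * C3)^-1 * ((2 `^ th) ^+ k)^-1)).
    rewrite invfM ler_pM2l ?invr_gt0// lef_pV2 ?posrE//.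
    apply: lerXn2r; rewrite ?nnegrE ?(ltW q0) ?(ltW b0)//.
    by rewrite ler_powR ?ler1n// /th; lra.
  by rewrite ler_pM2r ?invr_gt0// lerDr invr_ge0 ltW.
- move=> k w tw.
  have -> : ((2 * C1 * C3) `^ a * (b `^ a) ^+ k)%:E = ((2 * C1 * C3 * b ^+ k)%:E `^ a)%E.
    rewrite poweR_EFin [in RHS]powRM ?(ltW C0) ?exprn_ge0 ?(ltW b0)//.
    by rewrite exprn_powR// ltW.
  apply: gt0_ler_poweR => //; first exact: ltW.
  + by rewrite in_itv/= return_time0_ge0 leey.
  + by rewrite in_itv/= leey lee_fin mulr_ge0 ?exprn_ge0 ?(ltW C0) ?(ltW b0).
Qed.

(** On dyadic levels the scale is at most a multiple of [2 ^ (k a)], the order of the [a]-th power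
    of the time, also at the boundary exponent. *)
Lemma powR_moment_eq_pinfty (a : R) : 0 <= s - r < m -> 0 < a ->
  1 - (s - r) / m <= a -> (\int[P]_w (return_time0 X w `^ a) = +oo)%E.
Proof.
move=> sr a0 tha.
have [C1 C10 HC1] := scale_powR_le m r s m0 r0 s0 sr.
have c0 := growth_constant_gt0 m r s m0 r0 s0 rs.
set c := growth_constant m r s in c0 *.
have c40 : 0 < (4 * c)^-1 by rewrite invr_gt0 mulr_gt0.
apply: (integral_return_time_eq_pinfty _ (fun k => (2 ^ k)%N) ((4 * c)^-1 `^ a) C1 (2 `^ a)).
- by move=> w; exact: poweR_ge0.
- exact: powR_gt0.
- by [].
- by rewrite /powR pnatr_eq0/= expR_gt1 mulr_gt0// ln_gt0// ltr1n.
- by move=> k; rewrite expn_gt0.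
- move=> k; apply: (le_trans (HC1 _)); rewrite ler_pM2l// natrX exprn_powR//.
  by apply: lerXn2r; rewrite ?nnegrE ?powR_ge0// ler_powR ?ler1n.
- move=> k w tw; rewrite -/c in tw.
  have -> : ((4 * c)^-1 `^ a * (2 `^ a) ^+ k)%:E = (((2 ^ k)%:R / (4 * c))%:E `^ a)%E.
    by rewrite poweR_EFin [in RHS]mulrC powRM ?(ltW c40)// natrX exprn_powR.
  apply: gt0_ler_poweR => //; first exact: ltW.
  + by rewrite in_itv/= leey lee_fin divr_ge0// mulr_ge0// ltW.
  + by rewrite in_itv/= return_time0_ge0 leey.
Qed.

Lemma log_moment_lt_pinfty (g : R) : s - r = m -> 0 < g < 1 ->
  (\int[P]_w log_weight g (return_time0 X w) < +oo)%E.
Proof.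
move=> sr /andP[g0 g1].
(* Doubly exponential levels make the logarithm double: the tail decays like [2 ^- k] and the weight
   grows like [2 ^ (g k)]. *)
pose E k : R := expR (2 ^+ k).
pose N k := Num.truncn (E k).
(* The speed being [1], the time needed is at most [2 / s * E k ^+ 2]; the added [1] gives
   [ln A >= 0]. *)
pose A : R := 2 / s + 1.
have s20 : 0 < 2 / s by rewrite divr_gt0.
have A1 : 1 <= A by rewrite lerDr ltW.
have A0 : 0 < A by exact: lt_le_trans A1.
have E1 k : 1 <= E k by rewrite -expR0 ler_expR exprn_ge0.
have E0 k : 0 < E k by exact: expR_gt0.
have NE k : (N k)%:R <= E k < (N k).+1%:R by rewrite truncn_itv// ltW.
have N0 k : (0 < N k)%N by rewrite truncn_gt0.
(* The logarithm of [A * E k ^+ 2] is [ln A + 2 * 2 ^+ k], at most [B * 2 ^+ k]. *)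
pose B : R := ln A + 2.
have B1 : 1 <= B by rewrite /B -lerBlDr (le_trans _ (ln_ge0 A1))// subr_le0 ler1n.
have p2 k : 1 <= 2 ^+ k :> R by rewrite exprn_ege1// ler1n.
have p20 k : 0 < 2 ^+ k :> R by rewrite exprn_gt0.
have ms0 : 0 < m + s by rewrite addr_gt0.
have V k : 2^-1 ^+ k = (2 ^+ k)^-1 :> R by rewrite exprVn.
apply: (integral_return_time_lt_pinfty _ (fun k => A * E k ^+ 2) N (B `^ g)
  (m + s + 1) (2 `^ g) 2^-1).
- by move=> w; exact: log_weight_ge0.
- by rewrite powR_gt0// (lt_le_trans ltr01).
- by rewrite addr_gt0.
- by rewrite -[leLHS](powRr0 2) ler_powR ?ler1n// ltW.
- by rewrite invr_gt0.
- rewrite ltr_pdivrMr// mul1r -[ltRHS]powRr1//.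
  by rewrite /powR pnatr_eq0/= ltr_expR ltr_pM2r// ln_gt0// ltr1n.
- by move=> k; rewrite mulr_gt0 ?exprn_gt0.
- by [].
- move=> k; have /andP[NEk _] := NE k.
  rewrite (eq_bigr (fun=> 1)) ?sumr_const ?card_ord; last first.
    by move=> i _; exact: speed_critical.
  have sc := scale_critical_le_lin m r s m0 s0 sr (N k).
  apply: (@le_trans _ _ (2 * ((N k)%:R / s) * (N k)%:R)).
    by rewrite ler_wpM2r// ler_pM2l.
  apply: (@le_trans _ _ (2 / s * E k ^+ 2)).
    rewrite (_ : 2 * _ * _ = 2 / s * (N k)%:R ^+ 2); last by rewrite expr2; ring.
    by rewrite ler_pM2l// lerXn2r ?nnegrE// ltW.
  by rewrite ler_wpM2r ?exprn_ge0 ?(ltW (E0 k))// lerDl.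
- move=> k; have /andP[_ EN] := NE k; rewrite V.
  have sc := scale_critical_ge_ln m r s m0 s0 sr (N k).
  have lnN : 2 ^+ k <= ln (N k).+1%:R :> R.
    by rewrite -[leLHS]expRK ler_ln ?posrE ?expR_gt0// ltW.
  apply: (@le_trans _ _ ((m + s) / 2 ^+ k)); last first.
    by rewrite ler_pM2r ?invr_gt0// lerDl.
  rewrite -[leRHS]invrK lef_pV2 ?posrE; last 2 first.
  + by apply: scale_gt0 => //; [exact: alpha_gt0|exact: beta_gt0].
  + by rewrite invr_gt0 divr_gt0.
  apply: le_trans sc; rewrite invf_div ler_pM2r ?invr_gt0//.
- move=> k; rewrite V.
  apply: (@le_trans _ _ (2 ^+ k)^-1); last first.
    by rewrite ler_peMl ?invr_ge0 ?(ltW (p20 k))// lerDr ltW.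
  rewrite lef_pV2 ?posrE ?mulr_gt0 ?exprn_gt0//.
  have h1 : 2 ^+ k <= E k.
    by rewrite (le_trans _ (expR_ge1Dx _))// lerDr.
  apply: (le_trans h1); apply: (@le_trans _ _ (E k ^+ 2)).
    by rewrite expr2 ler_peMl// ltW.
  by rewrite ler_peMl// exprn_ge0// ltW.
- move=> k w tw.
  have -> : (B `^ g * (2 `^ g) ^+ k)%:E = ((B * 2 ^+ k) `^ g)%:E.
    by rewrite powRM ?exprn_powR// (le_trans ler01).
  apply: log_weight_le; first exact: ltW.
    by rewrite mulr_ege1.
  apply: (le_trans tw); rewrite lee_fin /E -expRM_natl -[A in X in X <= _]lnK ?posrE//.
  rewrite -expRD ler_expR /B (mulrDl (ln A)) lerD//.
  by rewrite ler_peMr// ln_ge0.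
Qed.

Lemma log_moment_eq_pinfty (g : R) : s - r = m -> 1 <= g ->
  (\int[P]_w log_weight g (return_time0 X w) = +oo)%E.
Proof.
move=> sr g1.
have c0 := growth_constant_gt0 m r s m0 r0 s0 rs.
set c := growth_constant m r s in c0 *.
have c40 : 0 < 4 * c by rewrite mulr_gt0.
(* As [A] is at least [4 * c], the time [M k / (4 * c)] is at least [E k]. *)
pose A := (Num.truncn (4 * c)).+1.
have A4 : 4 * c <= A%:R by rewrite ltW// truncnS_gt.
pose E k : R := expR (2 ^+ k).
have E1 k : 1 <= E k by rewrite -expR0 ler_expR exprn_ge0.
pose M k := (A * (Num.truncn (E k)).+1)%N.
have M0 k : (0 < M k)%N by rewrite muln_gt0.
have ME k : (M k)%:R <= 2 * A%:R * E k.
  rewrite natrM -(mulrC A%:R) -mulrA ler_pM2l ?ltr0n// -natr1.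
  have /andP[h _] := truncn_itv (le_trans ler01 (E1 k)).
  by have := E1 k; lra.
have p2 k : 1 <= 2 ^+ k :> R by rewrite exprn_ege1// ler1n.
have A1 : 1 <= 2 * A%:R :> R by rewrite -natrM ler1n.
(* This comes from [1 + ln (M k) <= (2 + ln (2 * A)) * 2 ^+ k]; then [1 <= g] allows replacing [2]
   by the power [2 ^ g]. *)
pose D : R := (m^-1 + s^-1) * (2 + ln (2 * A%:R)).
have ms0 : 0 < m^-1 + s^-1 by rewrite addr_gt0 ?invr_gt0.
have lA : 0 <= ln (2 * A%:R) :> R by exact: ln_ge0.
apply: (integral_return_time_eq_pinfty _ M 1 D (2 `^ g)).
- by move=> w; exact: log_weight_ge0.
- by [].
- by rewrite mulr_gt0// ltr_wpDr.
- rewrite /powR pnatr_eq0/= expR_gt1 mulr_gt0// ?ln_gt0 ?ltr1n//.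
  exact: lt_le_trans g1.
- by [].
- move=> k.
  have -> : M k = (M k).-1.+1 by rewrite prednK.
  apply: (le_trans (scale_critical_le_ln m r s m0 s0 sr _)); rewrite prednK//.
  rewrite -mulrA ler_pM2l//.
  have lnM' : ln (M k)%:R <= ln (2 * A%:R) + 2 ^+ k :> R.
    rewrite -[X in _ <= _ + X]expRK -lnM ?posrE ?expR_gt0 ?(lt_le_trans _ A1)//.
    by rewrite ler_ln ?posrE ?ltr0n// mulr_gt0 ?expR_gt0// (lt_le_trans _ A1).
  apply: (@le_trans _ _ ((2 + ln (2 * A%:R)) * 2 ^+ k)).
    have := p2 k; set y := 2 ^+ k in lnM' *; set z := ln (2 * A%:R) in lA lnM' * => y1.
    by nra.
  rewrite ler_wpM2l ?addr_ge0//.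
  apply: lerXn2r; rewrite ?nnegrE ?powR_ge0//.
  by rewrite -[leLHS]powRr1// ler_powR// ler1n.
- move=> k w tw; rewrite -/c in tw.
  rewrite mul1r -exprn_powR//; apply: log_weight_ge; first exact: lt_le_trans g1.
    exact: exprn_ge0.
  apply: le_trans tw; rewrite lee_fin ler_pdivlMr// natrM mulrC.
  by apply: ler_pM; rewrite ?(ltW c40) ?expR_ge0 ?A4// ltW// truncnS_gt.
Qed.

End Moments.

Theorem theorem5p4 (R : realType) (d : measure_display) (T : measurableType d)
    (P : probability T R) (X : R -> {RV P >-> nat}) (m r s : R)
    (hm : 0 < m) (hr : 0 <= r) (hs : 0 < s) (hsr : 0 <= s - r <= m)
    (hX : is_Markov_chain X (linear_growth_Q m r m s) 0%N) :
  (s - r = m -> forall gamma : R, 0 < gamma ->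
     ((\int[P]_w log_weight gamma (return_time0 X w) < +oo)%E <->
      0 < gamma < 1)) /\
  (0 <= s - r < m -> forall a : R, 0 < a ->
     ((\int[P]_w (return_time0 X w `^ a) < +oo)%E <->
      0 < a < 1 - (s - r) / m)).
Proof.
have hrs : r <= s by case/andP: hsr => h _; rewrite -subr_ge0.
split=> [sr g g0 | sr a a0]; split.
- move=> fin; rewrite g0/= ltNge; apply/negP => g1; move: fin.
  by rewrite (log_moment_eq_pinfty X m r s hm hr hs hrs hX g sr g1) ltxx.
- exact: (log_moment_lt_pinfty X m r s hm hr hs hX g sr).
- move=> fin; rewrite a0/= ltNge; apply/negP => a1; move: fin.
  by rewrite (powR_moment_eq_pinfty X m r s hm hr hs hrs hX a sr a0 a1) ltxx.
- exact: (powR_moment_lt_pinfty X m r s hm hr hs hX a sr).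
Qed.
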